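(* Let $\mathbb{K}$ be a field and let $H\subseteq\mathbb{Z}^3$ be the monoid generated by $$a_1=(1,0,0),\ a_2=(1,1,0),\ a_3=(1,3,0),\ a_4=(1,4,0),\ a_5=(1,1,1),\ a_6=(1,4,1).$$ Let $C=\{x\in\mathbb{Q}_+H\mid x_3=0\}$, which is a two-dimensional face of the cone $\mathbb{Q}_+H$, so that $H\cap C=\mathbb{N}a_1+\mathbb{N}a_2+\mathbb{N}a_3+\mathbb{N}a_4$. Then $\mathbb{K}[H]$ is Cohen--Macaulay, but the face ring $\mathbb{K}[H\cap C]$ is not Cohen--Macaulay. In particular, face rings of a Cohen--Macaulay toric ring are not Cohen--Macaulay in general, even when the generators of $H$ lie on an affine hyperplane not containing the origin.
   Context: For a submonoid $H\subseteq\mathbb{Z}^d$, $\mathbb{K}[H]=\bigoplus_{h\in H}\mathbb{K}\,t^h$ denotes the semigroup ring, and $\mathbb{Q}_+H\subseteq\mathbb{Q}^d$ is the rational cone spanned by $H$. *)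

(* Defs.v *)
From HB Require Import structures.
From mathcomp Require Import all_boot all_order all_algebra ring.
From mathcomp Require Import boolp finmap monalg.

Set Implicit Arguments.
Unset Strict Implicit.
Unset Printing Implicit Defensive.

Import GRing.Theory Num.Theory.
Local Open Scope ring_scope.
Local Open Scope quotient_scope.

(** * Localization of a commutative ring at a prime ideal *)

Section Localization.
Variables (R : comNzRingType) (P : prime_idealr R).

Record loc_denom : Type := LocDenom { den : R; denP : den \notin P }.
HB.instance Definition _ := [isSub for den].
HB.instance Definition _ := [Choice of loc_denom by <:].
Definition loc_frac : Type := (R * loc_denom)%type.
HB.instance Definition _ := Choice.on loc_frac.

Implicit Types x y z : loc_frac.
Implicit Types s t : loc_denom.

Lemma loc_denom1_subproof : 1 \notin (P : {pred R}).
Proof. by rewrite idealr1. Qed.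
Definition loc_denom1 : loc_denom := LocDenom loc_denom1_subproof.

Lemma loc_denomM_subproof s t : den s * den t \notin (P : {pred R}).
Proof. by rewrite prime_idealrM negb_or (denP s) (denP t). Qed.
Definition loc_denomM s t : loc_denom := LocDenom (loc_denomM_subproof s t).

(* The factor u is needed because R need not be a domain. *)
Definition loc_equiv x y : bool :=
  `[< exists u : loc_denom,
        den u * (x.1 * den y.2) = den u * (y.1 * den x.2) >].

Lemma loc_equivP x y :
  reflect (exists u : loc_denom,
             den u * (x.1 * den y.2) = den u * (y.1 * den x.2))
          (loc_equiv x y).
Proof. exact: asboolP. Qed.

Lemma loc_equiv_refl : reflexive loc_equiv.
Proof. by move=> x; apply/loc_equivP; exists loc_denom1. Qed.

Lemma loc_equiv_sym : symmetric loc_equiv.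
Proof.
by move=> x y; apply/loc_equivP/loc_equivP => -[u e]; exists u; rewrite e.
Qed.

Lemma loc_equiv_trans : transitive loc_equiv.
Proof.
move=> [b t] [a s] [c r] /loc_equivP[u /= eu] /loc_equivP[v /= ev].
apply/loc_equivP; exists (loc_denomM (loc_denomM u v) t) => /=.
transitivity (den v * den r * (den u * (a * den t))); first by ring.
rewrite eu; transitivity (den u * den s * (den v * (b * den r))); first by ring.
by rewrite ev; ring.
Qed.

Canonical loc_equiv_equiv :=
  EquivRel loc_equiv loc_equiv_refl loc_equiv_sym loc_equiv_trans.

Definition localization : Type := {eq_quot loc_equiv}.
HB.instance Definition _ : EqQuotient _ loc_equiv localization :=
  EqQuotient.on localization.
HB.instance Definition _ := Choice.on localization.

Local Notation loc := localization.

Lemma loc_eqP x y :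
  reflect (exists u : loc_denom,
             den u * (x.1 * den y.2) = den u * (y.1 * den x.2))
          (\pi_loc x == \pi_loc y).
Proof. by rewrite eqmodE; apply: loc_equivP. Qed.

Lemma loc_reprP x :
  exists u : loc_denom,
    den u * ((repr (\pi_loc x)).1 * den x.2)
    = den u * (x.1 * den (repr (\pi_loc x)).2).
Proof. by apply/loc_eqP; rewrite reprK. Qed.

Definition loc_zero_frac : loc_frac := (0, loc_denom1).
Definition loc_one_frac : loc_frac := (1, loc_denom1).
Definition loc_add_frac x y : loc_frac :=
  (x.1 * den y.2 + y.1 * den x.2, loc_denomM x.2 y.2).
Definition loc_opp_frac x : loc_frac := (- x.1, x.2).
Definition loc_mul_frac x y : loc_frac := (x.1 * y.1, loc_denomM x.2 y.2).

Definition loc_zero : loc := \pi_loc loc_zero_frac.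
Definition loc_one : loc := \pi_loc loc_one_frac.
Definition loc_add (a b : loc) : loc := \pi_loc (loc_add_frac (repr a) (repr b)).
Definition loc_opp (a : loc) : loc := \pi_loc (loc_opp_frac (repr a)).
Definition loc_mul (a b : loc) : loc := \pi_loc (loc_mul_frac (repr a) (repr b)).

Lemma pi_loc_add x y : loc_add (\pi_loc x) (\pi_loc y) = \pi_loc (loc_add_frac x y).
Proof.
apply/eqP/loc_eqP; have [u /= eu] := loc_reprP x; have [v /= ev] := loc_reprP y.
exists (loc_denomM u v) => /=; rewrite !mulrDl !mulrDr; congr (_ + _).
  set a' := (repr _).1 in eu *; set s' := den (repr _).2 in eu *.
  set b' := (repr _).1 in ev *; set t' := den (repr _).2 in ev *.
  transitivity (den v * t' * den y.2 * (den u * (a' * den x.2))); first by ring.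
  by rewrite eu; ring.
set a' := (repr _).1 in eu *; set s' := den (repr _).2 in eu *.
set b' := (repr _).1 in ev *; set t' := den (repr _).2 in ev *.
transitivity (den u * s' * den x.2 * (den v * (b' * den y.2))); first by ring.
by rewrite ev; ring.
Qed.

Lemma pi_loc_opp x : loc_opp (\pi_loc x) = \pi_loc (loc_opp_frac x).
Proof.
apply/eqP/loc_eqP; have [u /= eu] := loc_reprP x.
by exists u; rewrite /= !mulNr !mulrN eu.
Qed.

Lemma pi_loc_mul x y : loc_mul (\pi_loc x) (\pi_loc y) = \pi_loc (loc_mul_frac x y).
Proof.
apply/eqP/loc_eqP; have [u /= eu] := loc_reprP x; have [v /= ev] := loc_reprP y.
exists (loc_denomM u v) => /=.
set a' := (repr _).1 in eu *; set s' := den (repr _).2 in eu *.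
set b' := (repr _).1 in ev *; set t' := den (repr _).2 in ev *.
transitivity (den u * (a' * den x.2) * (den v * (b' * den y.2))); first by ring.
by rewrite eu ev; ring.
Qed.

Lemma loc_addA : associative loc_add.
Proof.
elim/quotW=> x; elim/quotW=> y; elim/quotW=> z.
rewrite (pi_loc_add y z) (pi_loc_add x y) (pi_loc_add x) (pi_loc_add _ z).
by apply/eqP/loc_eqP; exists loc_denom1 => /=; ring.
Qed.

Lemma loc_addC : commutative loc_add.
Proof.
elim/quotW=> x; elim/quotW=> y; rewrite (pi_loc_add x y) (pi_loc_add y x).
by apply/eqP/loc_eqP; exists loc_denom1 => /=; ring.
Qed.

Lemma loc_add0 : left_id loc_zero loc_add.
Proof.
elim/quotW=> x; rewrite (pi_loc_add _ x).
by apply/eqP/loc_eqP; exists loc_denom1 => /=; ring.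
Qed.

Lemma loc_addN : left_inverse loc_zero loc_opp loc_add.
Proof.
elim/quotW=> x; rewrite (pi_loc_opp x) (pi_loc_add _ x).
by apply/eqP/loc_eqP; exists loc_denom1 => /=; ring.
Qed.

HB.instance Definition _ :=
  GRing.isZmodule.Build loc loc_addA loc_addC loc_add0 loc_addN.

Lemma loc_mulA : associative loc_mul.
Proof.
elim/quotW=> x; elim/quotW=> y; elim/quotW=> z.
rewrite (pi_loc_mul y z) (pi_loc_mul x y) (pi_loc_mul x) (pi_loc_mul _ z).
by apply/eqP/loc_eqP; exists loc_denom1 => /=; ring.
Qed.

Lemma loc_mulC : commutative loc_mul.
Proof.
elim/quotW=> x; elim/quotW=> y; rewrite (pi_loc_mul x y) (pi_loc_mul y x).
by apply/eqP/loc_eqP; exists loc_denom1 => /=; ring.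
Qed.

Lemma loc_mul1 : left_id loc_one loc_mul.
Proof.
elim/quotW=> x; rewrite (pi_loc_mul _ x).
by apply/eqP/loc_eqP; exists loc_denom1 => /=; ring.
Qed.

Lemma loc_mulD : left_distributive loc_mul loc_add.
Proof.
elim/quotW=> x; elim/quotW=> y; elim/quotW=> z.
rewrite (pi_loc_add x y) (pi_loc_mul x z) (pi_loc_mul y z) (pi_loc_mul _ z).
rewrite (pi_loc_add (loc_mul_frac x z)).
by apply/eqP/loc_eqP; exists loc_denom1 => /=; ring.
Qed.

Lemma loc_one_neq0 : loc_one != loc_zero.
Proof.
apply/loc_eqP => -[u /=]; rewrite !mulr1 mulr0 => u0.
by have := denP u; rewrite u0 idealr0.
Qed.

HB.instance Definition _ := GRing.Zmodule_isComNzRing.Build loc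
  loc_mulA loc_mulC loc_mul1 loc_mulD loc_one_neq0.
End Localization.

(** * Cohen-Macaulay rings *)

Section CohenMacaulay.
Variable R : comNzRingType.

Definition ideal_gen (s : seq R) (x : R) : Prop :=
  exists c : 'I_(size s) -> R, x = \sum_(i < size s) c i * s`_i.

(* [idealr_closed] describes the proper ideals; the unit ideal is generated
   by [:: 1]. *)
Definition noetherian : Prop :=
  forall I : {pred R}, idealr_closed I ->
    exists s : seq R, forall x, x \in I <-> ideal_gen s x.

Definition maximal_ideal (M : {pred R}) : Prop :=
  idealr_closed M /\
  forall I : {pred R}, idealr_closed I -> {subset M <= I} -> I =i M.

Definition local_ring_with (M : {pred R}) : Prop :=
  maximal_ideal M /\ forall N : {pred R}, maximal_ideal N -> N =i M.

Definition prime_chain (n : nat) (p : 'I_n.+1 -> prime_idealr R) : Prop :=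
  forall i j : 'I_n.+1, (i < j)%N ->
    {subset p i <= p j} /\ ~ {subset p j <= p i}.

Definition krull_dim (n : nat) : Prop :=
  (exists p : 'I_n.+1 -> prime_idealr R, prime_chain p) /\
  forall k (p : 'I_k.+1 -> prime_idealr R), prime_chain p -> (k <= n)%N.

(* s_i is a nonzerodivisor modulo (s_0, ..., s_(i-1)), and (s) is proper. *)
Definition regular_sequence (s : seq R) : Prop :=
  (forall i, (i < size s)%N -> forall y : R,
     ideal_gen (take i s) (s`_i * y) -> ideal_gen (take i s) y)
  /\ ~ ideal_gen s 1.

Definition depth_at (M : {pred R}) (n : nat) : Prop :=
  (exists s, [/\ regular_sequence s, {subset s <= M} & size s = n]) /\
  forall s, regular_sequence s -> {subset s <= M} -> (size s <= n)%N.

Definition cohen_macaulay_local : Prop :=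
  noetherian /\
  exists M : {pred R}, local_ring_with M /\
    exists n, depth_at M n /\ krull_dim n.
End CohenMacaulay.

Definition cohen_macaulay (R : comNzRingType) : Prop :=
  noetherian R /\
  forall P : prime_idealr R, maximal_ideal P ->
    cohen_macaulay_local (localization P).

(** * Semigroup rings *)

(* multinomials equips {malg K[M]} with a product only when M is a monomType,
   i.e. has no nontrivial units; the alias carries the convolution product
   for an arbitrary commutative monoid M, written additively. *)
Definition monoid_algebra (K : fieldType) (M : nmodType) : Type :=
  {malg K[M]}.

Section MonoidAlgebra.
Variables (K : fieldType) (M : nmodType).
Local Notation A := (monoid_algebra K M).
Implicit Types f g h : A.

HB.instance Definition _ := GRing.Lmodule.copy A {malg K[M]}.

Definition ma_one : A := << 1 *g 0 >>.
Definition ma_mul f g : A :=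
  \sum_(a <- msupp f) \sum_(b <- msupp g) << f@_a * g@_b *g (a + b)%R >>.

Local Open Scope fset_scope.

Lemma ma_mulw (d1 d2 : {fset M}) f g :
  msupp f `<=` d1 -> msupp g `<=` d2 ->
  ma_mul f g = \sum_(a <- d1) \sum_(b <- d2) << f@_a * g@_b *g (a + b)%R >>.
Proof.
move=> le1 le2; rewrite /ma_mul (big_fset_incl _ le1) /=.
  apply: eq_bigr => a _; apply: big_fset_incl => // b _ /mcoeff_outdom ->.
  by rewrite mulr0 monalgU0.
move=> a _ /mcoeff_outdom fa.
by rewrite big1 // => b _; rewrite fa mul0r monalgU0.
Qed.

Lemma ma_mulC : commutative ma_mul.
Proof.
move=> f g; rewrite /ma_mul exchange_big /=; apply: eq_bigr => a _.
by apply: eq_bigr => b _; rewrite mulrC addrC.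
Qed.

Lemma ma_mulDl : left_distributive ma_mul +%R.
Proof.
move=> f g h; rewrite (ma_mulw (msuppD_le f g) (fsubset_refl _)).
rewrite (ma_mulw (fsubsetUl (msupp f) (msupp g)) (fsubset_refl _)).
rewrite (ma_mulw (fsubsetUr (msupp f) (msupp g)) (fsubset_refl _)).
rewrite -big_split /=; apply: eq_bigr => a _.
rewrite -big_split /=; apply: eq_bigr => b _.
by rewrite mcoeffD mulrDl monalgUD.
Qed.

Lemma ma_mulDr : right_distributive ma_mul +%R.
Proof. by move=> f g h; rewrite ma_mulC ma_mulDl !(ma_mulC f). Qed.

Lemma ma_mul0 : right_zero 0 ma_mul.
Proof. by move=> f; rewrite ma_mulC /ma_mul msupp0 big_seq_fset0. Qed.

Lemma ma_mulUU (x y : K) (a b : M) :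
  ma_mul << x *g a >> << y *g b >> = << x * y *g (a + b)%R >>.
Proof. by rewrite (ma_mulw msuppU_le msuppU_le) !big_seq_fset1 !mcoeffUU. Qed.

Lemma ma_suml (I : Type) (r : seq I) (F : I -> A) g :
  ma_mul (\sum_(i <- r) F i) g = \sum_(i <- r) ma_mul (F i) g.
Proof.
apply: (big_morph (ma_mul^~ g)) => [f h|]; first exact: ma_mulDl.
by rewrite ma_mulC ma_mul0.
Qed.

Lemma ma_sumr (I : Type) (r : seq I) (F : I -> A) g :
  ma_mul g (\sum_(i <- r) F i) = \sum_(i <- r) ma_mul g (F i).
Proof.
by rewrite ma_mulC ma_suml; apply: eq_bigr => i _; rewrite ma_mulC.
Qed.

Lemma ma_mulA : associative ma_mul.
Proof.
move: (@ma_suml) (@ma_sumr) ma_mulUU; move: ma_mul => mul sl sr mulUU f g h.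
rewrite (monalgE f) (monalgE g) (monalgE h) !sl.
apply: eq_bigr => a _; rewrite [LHS]sr [X in _ = mul X _]sr sl.
apply: eq_bigr => b _; rewrite !sr; apply: eq_bigr => c _.
by rewrite !mulUU mulrA addrA.
Qed.

Lemma ma_mul1 : left_id ma_one ma_mul.
Proof.
move=> f; rewrite {1}(monalgE f) ma_sumr [RHS]monalgE.
by apply: eq_bigr => a _; rewrite ma_mulUU mul1r add0r.
Qed.

Lemma ma_one_neq0 : ma_one != 0.
Proof. by rewrite monalgU_eq0 oner_eq0. Qed.

HB.instance Definition _ := GRing.Zmodule_isComNzRing.Build A
  ma_mulA ma_mulC ma_mul1 ma_mulDl ma_one_neq0.
End MonoidAlgebra.

Record submonoid_of (V : nmodType) (S : addrClosed V) : Type :=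
  SubmonoidOf { submonoid_val : V; _ : submonoid_val \in S }.

Section SubmonoidOf.
Variables (V : nmodType) (S : addrClosed V).
HB.instance Definition _ := [isSub for @submonoid_val V S].
HB.instance Definition _ := [Choice of submonoid_of S by <:].
Lemma submonoid_closed : GRing.nmod_closed (fun x : V => x \in S).
Proof. by split=> [|x y]; [apply: rpred0 | apply: rpredD]. Qed.
HB.instance Definition _ :=
  GRing.SubChoice_isSubNmodule.Build V (fun x : V => x \in S) (submonoid_of S)
    submonoid_closed.
End SubmonoidOf.

Definition semigroup_ring (K : fieldType) d (H : addrClosed 'rV[int]_d) :
  comNzRingType := monoid_algebra K (submonoid_of H).

(** * Affine monoids, cones and faces *)

Section Cones.
Variable d : nat.
Implicit Types (s : seq 'rV[int]_d) (H : {pred 'rV[int]_d}).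
Implicit Types C F : {pred 'rV[rat]_d}.

Definition gen_monoid s : {pred 'rV[int]_d} :=
  fun x => `[< exists n : 'I_(size s) -> nat, x = \sum_(i < size s) s`_i *+ n i >].

Lemma gen_monoid_closed s : GRing.nmod_closed (gen_monoid s).
Proof.
split.
  by apply/asboolP; exists (fun=> 0%N); rewrite big1 // => i _; rewrite mulr0n.
move=> x y /asboolP[m ->] /asboolP[n ->]; apply/asboolP.
exists (fun i => m i + n i)%N; rewrite -big_split /=.
by apply: eq_bigr => i _; rewrite mulrnDr.
Qed.
HB.instance Definition _ s :=
  GRing.isAddClosed.Build _ (gen_monoid s) (gen_monoid_closed s).

Definition ratv (x : 'rV[int]_d) : 'rV[rat]_d := map_mx intr x.

Definition rational_cone H : {pred 'rV[rat]_d} :=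
  fun x => `[< exists r : seq (rat * 'rV[int]_d),
    (forall p, p \in r -> 0 <= p.1 /\ p.2 \in H)
    /\ x = \sum_(p <- r) p.1 *: ratv p.2 >].

Lemma rational_cone_closed H : GRing.nmod_closed (rational_cone H).
Proof.
split; first by apply/asboolP; exists [::]; rewrite big_nil.
move=> x y /asboolP[r [rP ->]] /asboolP[t [tP ->]]; apply/asboolP.
exists (r ++ t); rewrite big_cat; split=> // p.
by rewrite mem_cat => /orP[/rP|/tP].
Qed.
HB.instance Definition _ H :=
  GRing.isAddClosed.Build _ (rational_cone H) (rational_cone_closed H).

Definition linear_form (phi : 'cV[rat]_d) (x : 'rV[rat]_d) : rat :=
  (x *m phi) 0 0.

(* Faces are cut out by supporting hyperplanes; phi = 0 gives C itself. *)
Definition is_face C F : Prop :=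
  exists phi : 'cV[rat]_d,
    (forall x, x \in C -> 0 <= linear_form phi x) /\
    F =i [pred x in C | linear_form phi x == 0].

(* The dimension of a cone is that of its linear span U. *)
Definition cone_dim C (n : nat) : Prop :=
  exists U : {vspace 'rV[rat]_d},
    [/\ {subset C <= U},
        forall W : {vspace 'rV[rat]_d}, {subset C <= W} -> (U <= W)%VS
      & \dim U = n].

Definition lattice_points (H : {pred 'rV[int]_d}) C : {pred 'rV[int]_d} :=
  [pred x | (x \in H) && (ratv x \in C)].

Lemma lattice_points_closed (H : addrClosed 'rV[int]_d)
    (C : addrClosed 'rV[rat]_d) : GRing.nmod_closed (lattice_points H C).
Proof.
split; first by rewrite inE !rpred0 /ratv map_mx0 rpred0.
move=> x y /andP[Hx Cx] /andP[Hy Cy].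
by rewrite inE rpredD //= /ratv map_mxD rpredD.
Qed.
HB.instance Definition _ (H : addrClosed 'rV[int]_d)
    (C : addrClosed 'rV[rat]_d) :=
  GRing.isAddClosed.Build _ (lattice_points H C) (lattice_points_closed H C).

Definition on_affine_hyperplane s : Prop :=
  exists (phi : 'cV[rat]_d) (c : rat),
    [/\ phi != 0, c != 0 & forall a, a \in s -> linear_form phi (ratv a) = c].
End Cones.

(** * The example *)

Definition vec3 (x y z : int) : 'rV[int]_3 := \row_(j < 3) [:: x; y; z]`_j.

Definition gens_C : seq 'rV[int]_3 :=
  [:: vec3 1 0 0; vec3 1 1 0; vec3 1 3 0; vec3 1 4 0].
Definition gens_H : seq 'rV[int]_3 :=
  gens_C ++ [:: vec3 1 1 1; vec3 1 4 1].

Definition H_ex : addrClosed 'rV[int]_3 := gen_monoid gens_H.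

(* The third coordinate of x is x 0 ord_max. *)
Definition cone_C : {pred 'rV[rat]_3} :=
  [pred x | (x \in rational_cone H_ex) && (x 0 ord_max == 0)].

Lemma cone_C_closed : GRing.nmod_closed cone_C.
Proof.
split; first by rewrite inE rpred0 mxE eqxx.
move=> x y /andP[Hx /eqP Cx] /andP[Hy /eqP Cy].
by rewrite inE rpredD //= mxE Cx Cy addr0.
Qed.
HB.instance Definition _ := GRing.isAddClosed.Build _ cone_C cone_C_closed.

(* Main.v *)
(** Positive part.  In the coordinates m = y - 4 n + 3 k and i = n - k of a
    point (n, y, k), the monoid H is {i >= min_i m, k >= min_k m}, so K[H] is
    free over K[u, v], u = t^a4, v = t^a5, with one basis vector for each
    integer m.  The third parameter is w = t^a1 - t^a6: modulo an ideal of
    K[u, v], multiplication by t^a6 is an exact shift m -> m + 3 for m >= -2 and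
    multiplication by t^a1 an exact shift m -> m - 4 for m <= -3, so that
    looking at an extremal coordinate shows that f(u), g(v), h(w) is a regular
    sequence for all nonzero one-variable polynomials f, g, h.  By the
    Nullstellensatz every maximal ideal contains such a sequence, and the
    dimension is at most 3 because four elements of K[H] are algebraically
    dependent (count monomials of bounded degree).  No depth can exceed the
    dimension, since a regular sequence yields a chain of primes.

    Negative part.  b = t^(1, 2, 0) is not in the face ring, although b P is
    contained in it for the maximal ideal P of the origin.  If x, y were a regular sequence
    in P then (b x) y = x (b y) would give b x in (x), hence b in the ring; so
    the depth at P is at most 1, while P has height at least 2. *)
Require Import Defs.
From HB Require Import structures.
From mathcomp Require Import all_boot all_order all_algebra zify ring.
From mathcomp Require Import boolp classical_sets finmap monalg.

Set Implicit Arguments.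
Unset Strict Implicit.
Unset Printing Implicit Defensive.

Import GRing.Theory Num.Theory.
Local Open Scope ring_scope.
Local Open Scope quotient_scope.

(** * Ideals and Hilbert's basis theorem *)

Section Ideals.
Variable R : comNzRingType.
Implicit Types (I J : R -> Prop) (s t : seq R).

(** Unlike [idealr_closed], this admits the unit ideal, so every ideal given by generators
    qualifies. *)
Definition is_ideal I : Prop :=
  [/\ I 0, forall x y, I x -> I y -> I (x + y) & forall a x, I x -> I (a * x)].

Lemma is_idealB I x y : is_ideal I -> I x -> I y -> I (x - y).
Proof. by case=> _ ID IM Ix Iy; apply: ID => //; rewrite -mulN1r; apply: IM. Qed.

Lemma is_ideal_sum I (T : eqType) (r : seq T) (P : pred T) (F : T -> R) :
  is_ideal I -> (forall i, i \in r -> P i -> I (F i)) ->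
  I (\sum_(i <- r | P i) F i).
Proof.
case=> I0 ID _; elim: r => [|i r IH] IF; first by rewrite big_nil.
rewrite big_cons; have {}IH : I (\sum_(j <- r | P j) F j).
  by apply: IH => j jr; apply: IF; rewrite inE jr orbT.
by case: ifP => // Pi; apply: ID => //; apply: IF; rewrite ?mem_head.
Qed.

Lemma ideal_genP s x :
  ideal_gen s x <-> exists c : nat -> R, x = \sum_(i < size s) c i * s`_i.
Proof.
split=> [[c ->]|[c ->]]; last by exists (fun i => c i).
exists (fun n => if insub n is Some i then c i else 0).
by apply: eq_bigr => i _; rewrite valK.
Qed.

Lemma ideal_gen_ideal s : is_ideal (ideal_gen s).
Proof.
split; first by exists (fun=> 0); rewrite big1 // => i _; rewrite mul0r.
  move=> _ _ [c ->] [d ->]; exists (fun i => c i + d i).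
  by rewrite -big_split; apply: eq_bigr => i _; rewrite mulrDl.
move=> a _ [c ->]; exists (fun i => a * c i).
by rewrite mulr_sumr; apply: eq_bigr => i _; rewrite mulrA.
Qed.

Lemma ideal_gen_mem s x : x \in s -> ideal_gen s x.
Proof.
case/(nthP 0) => i lis <-; exists (fun j => (j == Ordinal lis)%:R).
rewrite (bigD1 (Ordinal lis)) //= eqxx mul1r big1 ?addr0 // => j /negPf->.
by rewrite mul0r.
Qed.

Lemma ideal_gen_min s I x :
  is_ideal I -> {in s, forall y, I y} -> ideal_gen s x -> I x.
Proof.
move=> idI sI [c ->]; apply: is_ideal_sum => // i _ _.
by case: idI => _ _; apply; apply: sI; rewrite mem_nth.
Qed.

Lemma ideal_gen_sub s t x : {subset s <= t} -> ideal_gen s x -> ideal_gen t x.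
Proof.
move=> st; apply: ideal_gen_min => [|y /st]; first exact: ideal_gen_ideal.
exact: ideal_gen_mem.
Qed.

Lemma ideal_gen_nil x : ideal_gen (R:=R) [::] x <-> x = 0.
Proof.
split=> [[c ->]|->]; first by rewrite big_ord0.
by case: (ideal_gen_ideal [::]).
Qed.

Lemma ideal_gen_rcons s a x :
  ideal_gen (rcons s a) x <-> exists c y, ideal_gen s y /\ x = y + c * a.
Proof.
split=> [/ideal_genP[c ->]|[c [y [sy ->]]]].
  rewrite size_rcons big_ord_recr /= nth_rcons ltnn eqxx.
  exists (c (size s)), (\sum_(i < size s) c i * s`_i); split.
    by apply/ideal_genP; exists c.
  by congr (_ + _); apply: eq_bigr => i _; rewrite nth_rcons ltn_ord.
have [_ ID IM] := ideal_gen_ideal (rcons s a); apply: ID.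
  by apply: ideal_gen_sub sy => z zs; rewrite mem_rcons inE zs orbT.
by apply/IM/ideal_gen_mem; rewrite mem_rcons mem_head.
Qed.

Lemma idealr_closed_ideal (S : {pred R}) :
  idealr_closed S -> is_ideal (fun x => x \in S).
Proof.
case=> S0 _ Sl; split=> // [x y Sx Sy|a x Sx]; first by rewrite -[x]mul1r Sl.
by rewrite -[_ * _]addr0 Sl.
Qed.

Lemma ideal_idealr_closed I :
  is_ideal I -> ~ I 1 -> idealr_closed (fun x => `[< I x >] : bool).
Proof.
case=> I0 ID IM I1; split; first exact/asboolP.
  by apply/negP => /asboolP.
by move=> a x y /asboolP Ix /asboolP Iy; apply/asboolP/ID => //; apply: IM.
Qed.

Lemma prime_ideal (P : prime_idealr R) : is_ideal (fun x => x \in P).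
Proof.
split=> [|x y|a x]; [exact: idealr0|exact: rpredD|exact: idealMr].
Qed.

Lemma prime_idealr_idealr_closed (P : prime_idealr R) : idealr_closed P.
Proof.
split; [exact: idealr0|by rewrite idealr1|].
by move=> a x y Px Py; apply: rpredD => //; apply: idealMr.
Qed.

Lemma prime_idealr_exists I :
  is_ideal I -> ~ I 1 -> (forall x y, I (x * y) -> I x \/ I y) ->
  exists P : prime_idealr R, forall x, (x \in P) <-> I x.
Proof.
move=> idI I1 Ip; pose S : R -> bool := fun x => `[< I x >].
have Sp : prime_idealr_closed (S : {pred R}).
  by move=> x y /asboolP/Ip[] ?; apply/orP; [left|right]; apply/asboolP.
pose P : prime_idealr R := HB.pack S
  (isIdealr.Build R S (ideal_idealr_closed idI I1))
  (isPrimeIdealrClosed.Build R S Sp).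
by exists P => x; split=> [/asboolP|Ix] //; apply/asboolP.
Qed.

Lemma noetherianP :
  noetherian R <->
  forall I, is_ideal I -> exists s, forall x, I x <-> ideal_gen s x.
Proof.
split=> noethR I => [idI|/idealr_closed_ideal /noethR[s sP]]; last by exists s.
have [I1|I1] := pselect (I 1).
  exists [:: 1] => x; split=> _.
    exists (fun=> x); by rewrite big_ord1 mulr1.
  by rewrite -[x]mulr1; case: idI => _ _; apply.
have [s sP] := noethR _ (ideal_idealr_closed idI I1).
by exists s => x; rewrite -sP; split=> [Ix|/asboolP]; first exact/asboolP.
Qed.

(** The ideals (a_0, ..., a_(n-1)) increase; finitely many generators of their union already lie in
    one of them, and so does the next a_n. *)
Lemma noetherian_seq (a : nat -> R) :
  noetherian R -> exists n, ideal_gen (mkseq a n) (a n).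
Proof.
move/noetherianP => noethR.
pose I x := exists n, ideal_gen (mkseq a n) x.
have sub n m : (n <= m)%N -> {subset mkseq a n <= mkseq a m}.
  move=> nm x /mapP[i]; rewrite mem_iota => /= ilt ->.
  by apply: map_f; rewrite mem_iota /=; lia.
have idI : is_ideal I.
  split=> [|x y [n xn] [m ym]|b x [n xn]].
  - by exists 0%N; case: (ideal_gen_ideal (mkseq a 0)).
  - exists (n + m)%N; case: (ideal_gen_ideal (mkseq a (n + m))) => _ ID _.
    by apply: ID; [apply: ideal_gen_sub xn|apply: ideal_gen_sub ym];
      apply: sub; lia.
  - by exists n; case: (ideal_gen_ideal (mkseq a n)) => _ _; apply.
have [s sP] := noethR I idI.
have [n sn] : exists n, {in s, forall x, ideal_gen (mkseq a n) x}.
  have : {in s, forall x, I x} by move=> x xs; apply/sP/ideal_gen_mem.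
  elim: {sP} s => [|x s IH] sI; first by exists 0%N.
  have [|m sm] := IH; first by move=> y ys; apply: sI; rewrite inE ys orbT.
  have [k xk] := sI x (mem_head _ _); exists (m + k)%N => y.
  rewrite inE => /predU1P[->|/sm ym].
    by apply: ideal_gen_sub xk; apply: sub; lia.
  by apply: ideal_gen_sub ym; apply: sub; lia.
exists n; apply: (ideal_gen_min (ideal_gen_ideal _) sn); apply/sP.
exists n.+1; apply: ideal_gen_mem; apply: map_f; rewrite mem_iota /=; lia.
Qed.
End Ideals.

(** Hilbert's argument by contradiction: each f_n has least degree in I outside (f_0, ..., f_(n-1)).
    Some leading coefficient is a combination of the earlier ones, and cancelling it produces an
    element of smaller degree. *)
Lemma noetherian_poly (R : comNzRingType) : noetherian R -> noetherian {poly R}.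
Proof.
move=> noethR; apply/noetherianP => I idI; apply: contrapT => nfg.
pose good s f := [/\ I f, ~ ideal_gen s f
  & forall g, I g -> ~ ideal_gen s g -> (size f <= size g)%N].
(* The condition on s stands inside the existential, with value 0 when it fails, so that choice
   gives a total function [step]. *)
have ex s : exists f, {in s, forall g, I g} -> good s f.
  have [sI|nsI] := pselect {in s, forall g, I g}; last by exists 0.
  have [f [If nf]] : exists f, I f /\ ~ ideal_gen s f.
    apply: contrapT => nex; apply: nfg; exists s => f; split=> [If|].
      by apply: contrapT => nf; apply: nex; exists f.
    exact: ideal_gen_min.
  have : exists n, `[< exists f, [/\ I f, ~ ideal_gen s f & size f = n] >].
    by exists (size f); apply/asboolP; exists f.
  case/ex_minnP=> n /asboolP[g [Ig ng sg]] min; exists g => _; split=> // h Ih nh.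
  by rewrite sg min //; apply/asboolP; exists h.
have [step stepP] := choice ex.
pose L := fix L n := if n is n'.+1 then rcons (L n') (step (L n')) else [::].
pose f n := step (L n).
have LE n : L n = mkseq f n.
  by elim: n => // n IH; rewrite [LHS]/= -/(f n) IH mkseqS.
have IL n : {in L n, forall g, I g}.
  elim: n => [|n IH] g //=; rewrite mem_rcons inE => /predU1P[->|/IH //].
  by case: (stepP (L n) IH).
have fP n : good (L n) (f n) by apply: stepP.
clearbody f.
have f0 n : f n != 0.
  have [_ nfn _] := fP n; apply/eqP => fn0; apply: nfn; rewrite fn0.
  by case: (ideal_gen_ideal (L n)).
have fle i n : (i <= n)%N -> (size (f i) <= size (f n))%N.
  move=> lin; have [_ _ min] := fP i; have [In nn _] := fP n.
  apply: min => // fi; apply: nn; apply: ideal_gen_sub fi => g.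
  rewrite !LE => /mapP[j]; rewrite mem_iota => /= jlt ->.
  by apply: map_f; rewrite mem_iota /=; lia.
have [n /ideal_genP[c]] := noetherian_seq (fun n => lead_coef (f n)) noethR.
rewrite size_mkseq => cE.
(* The powers of ['X] raise each f_i to the degree of f_n, so [f n - h] loses the leading term while
   staying in I and outside the ideal of [L n]. *)
pose h := \sum_(i < n) (c i)%:P * 'X^(size (f n) - size (f i)) * f i.
have Lh : ideal_gen (L n) h.
  apply: is_ideal_sum => [|i _ _]; first exact: ideal_gen_ideal.
  have [_ _ IM] := ideal_gen_ideal (L n); apply/IM/ideal_gen_mem.
  by rewrite LE map_f // mem_iota /=.
have [Ifn nfn min] := fP n.
have := min (f n - h); rewrite leqNgt => /(_ _ _)/negP; apply.
- by apply: is_idealB => //; apply: ideal_gen_min Lh => //; apply: IL.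
- move=> gfh; apply: nfn; rewrite -(subrK h (f n)).
  by case: (ideal_gen_ideal (L n)) => _ ID _; apply: ID.
have sf : (0 < size (f n))%N by rewrite size_poly_gt0.
rewrite -(prednK sf) ltnS; apply/leq_sizeP => j.
rewrite leq_eqVlt => /predU1P[<-|lj].
  rewrite coefB -lead_coefE cE /h coef_sum -sumrB big1 // => i _.
  rewrite nth_mkseq // -mulrA coefCM coefXnM.
  have := fle i n (ltnW (ltn_ord i)) => le_i.
  have si : (0 < size (f i))%N by rewrite size_poly_gt0.
  rewrite ifF; last by lia.
  have -> : ((size (f n)).-1 - (size (f n) - size (f i)) = (size (f i)).-1)%N.
    by lia.
  by rewrite -lead_coefE subrr.
rewrite coefB nth_default; last by rewrite -(prednK sf).
rewrite sub0r /h coef_sum big1 ?oppr0 // => i _.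
have := fle i n (ltnW (ltn_ord i)) => le_i.
rewrite -mulrA coefCM coefXnM; case: ifP => _; first by rewrite mulr0.
rewrite nth_default ?mulr0 //.
by move: lj sf le_i; move: (size (f n)) (size (f i)) => u v; lia.
Qed.

(* Impredicative, so that generators can be permuted and moved into the base
   ring at no cost. *)
Definition generated_over (D S : nzRingType) (i : D -> S) (bs : seq S) : Prop :=
  forall (y : S) (Q : S -> Prop), (forall x, Q (i x)) -> {in bs, forall b, Q b} ->
    (forall x z, Q x -> Q z -> Q (x + z)) ->
    (forall x z, Q x -> Q z -> Q (x * z)) -> Q y.

Section Adjoin.
Variables (D S : comNzRingType) (i : {rmorphism D -> S}) (b : S).

Lemma adjoin_comm : commr_rmorph i b. Proof. by move=> x; apply: mulrC. Qed.

Definition adjoin : {rmorphism {poly D} -> S} := horner_morph adjoin_comm.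

Lemma adjoinE p : adjoin p = (map_poly i p).[b]. Proof. by []. Qed.

Lemma adjoinC x : adjoin x%:P = i x.
Proof. by rewrite adjoinE map_polyC hornerC. Qed.

Lemma adjoinX : adjoin 'X = b.
Proof. by rewrite adjoinE map_polyX hornerX. Qed.

Lemma generated_over_adjoin bs cs :
  (forall c, c \in cs -> c = b \/ c \in bs) ->
  generated_over i cs -> generated_over adjoin bs.
Proof.
move=> sub gen y Q Qi Qb QD QM; apply: (gen y) => // [x|c /sub[->|/Qb//]].
  by rewrite -adjoinC.
by rewrite -adjoinX.
Qed.
End Adjoin.

(** Each generator is absorbed into the base ring, which becomes D[X] and stays noetherian. Without
    generators i is onto, and an ideal is generated by the image of generators of its preimage. *)
Lemma noetherian_generated (S : comNzRingType) (bs : seq S) :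
  forall (D : comNzRingType) (i : {rmorphism D -> S}),
  noetherian D -> generated_over i bs -> noetherian S.
Proof.
elim: bs => [|b bs IH] D i noethD gen; last first.
  apply: (IH _ (adjoin i b)); first exact: noetherian_poly.
  by apply: generated_over_adjoin gen => c; rewrite inE => /predU1P.
have isurj y : exists x, i x = y.
  apply: (gen y (fun y => exists x, i x = y)) => [x|//|_ _ [x <-] [z <-]|];
    first by exists x.
    by exists (x + z); rewrite rmorphD.
  by move=> _ _ [x <-] [z <-]; exists (x * z); rewrite rmorphM.
apply/noetherianP => I [I0 ID IM].
have idJ : is_ideal (fun x => I (i x)).
  split=> [|x z|a x]; rewrite ?rmorph0 ?rmorphD ?rmorphM //; first exact: ID.
  exact: IM.
have /noetherianP/(_ _ idJ)[s sP] := noethD.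
exists (map i s) => y; split.
  have [x <-] := isurj y; move=> /sP[c ->]; rewrite rmorph_sum.
  apply: is_ideal_sum => [|j _ _]; first exact: ideal_gen_ideal.
  rewrite rmorphM; case: (ideal_gen_ideal (map i s)) => _ _; apply.
  by apply/ideal_gen_mem/map_f/mem_nth.
by apply: ideal_gen_min => // _ /mapP[x xs ->]; apply/sP/ideal_gen_mem.
Qed.

Lemma noetherian_field (K : fieldType) : noetherian K.
Proof.
apply/noetherianP => I [I0 ID IM].
have [[x [Ix x0]]|nI] := pselect (exists x, I x /\ x != 0).
  exists [:: 1] => y; split=> _; last by rewrite -(divfK x0 y); apply: IM.
  by exists (fun=> y); rewrite big_ord1 mulr1.
exists [::] => y; rewrite ideal_gen_nil; split=> [Iy|-> //].
by apply/eqP; apply: contrapT => /negP y0; apply: nI; exists y.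
Qed.

(** * Nullstellensatz *)

(* If d^k = e w with e = 1 + 'X d, then 'X^k d^k is both a multiple of e and
   congruent to a sign modulo e, so that e is a unit. *)
Lemma poly_not_Goldman (D : idomainType) (d : {poly D}) :
  d != 0 -> ~ (forall e, e != 0 -> exists k w, d ^+ k = e * w).
Proof.
move=> d0 Gd; pose e := 1 + 'X * d.
have se : (1 < size e)%N.
  have sXd : (1 < size ('X * d)%R)%N.
    by rewrite size_mul ?polyX_eq0 // size_polyX add2n ltnS size_poly_gt0.
  by rewrite /e addrC size_polyDl // size_poly1.
have e0 : e != 0 by rewrite -size_poly_gt0; apply: ltn_trans se.
have [k [w dk]] := Gd e e0.
have [q qE] : exists q, ('X * d) ^+ k = (-1) ^+ k + e * q.
  elim: {dk} k => [|k [q IH]]; first by exists 0; rewrite mulr0 addr0.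
  by exists ((-1) ^+ k + 'X * d * q); rewrite !exprS IH /e; ring.
have eu : e * ('X^k * w - q) = (-1) ^+ k * 1.
  by rewrite mulr1 mulrBr mulrCA -dk -exprMn qE addrK.
have /eqP := size_Msign (1 : {poly D}) k.
by rewrite -eu size_poly1 size_mul_eq1 gtn_eqF.
Qed.

Section IntegralMultiple.
Variables (D : idomainType) (F : comNzRingType) (i : {rmorphism D -> F}).
Hypothesis i_inj : injective i.

(** With n the degree of p and l its leading coefficient, l^(n-1) p(b) = 0 is a monic equation for l
    b. *)
Lemma algebraic_integral_multiple (b : F) (p : {poly D}) :
  p != 0 -> adjoin i b p = 0 -> exists2 l, l != 0 & integralOver i (i l * b).
Proof.
move=> p0 pb; pose l := lead_coef p; pose n := (size p).-1.
have l0 : l != 0 by rewrite lead_coef_eq0.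
have sp : size p = n.+1 by rewrite prednK // size_poly_gt0.
have n0 : (0 < n)%N.
  rewrite lt0n; apply/eqP => n0; move: pb.
  have /size_poly1P[c c0 ->] : size p == 1%N by rewrite sp n0.
  by rewrite adjoinC -[RHS](rmorph0 i) => /i_inj/eqP; rewrite (negPf c0).
exists l => //.
pose q := \poly_(j < n.+1) (if j == n then 1 else p`_j * l ^+ (n.-1 - j)).
have qn : q`_n = 1 by rewrite coef_poly ltnSn eqxx.
exists q.
  rewrite monicE lead_coefE -[X in X == 1]/(q`_(size q).-1).
  suff -> : size q = n.+1 by rewrite qn.
  apply/eqP; rewrite eqn_leq size_poly /= ltnNge; apply/negP => sq.
  by move: qn; rewrite nth_default // => /esym/eqP; rewrite oner_eq0.
rewrite /root (horner_coef_wide _ (_ : _ <= n.+1)%N); last first.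
  by apply: leq_trans (size_poly _ _) (size_poly _ _).
have: i l ^+ n.-1 * adjoin i b p = 0 by rewrite pb mulr0.
rewrite adjoinE (horner_coef_wide _ (_ : _ <= n.+1)%N); last first.
  by rewrite -sp size_poly.
rewrite mulr_sumr => e; rewrite -[X in _ == X]e; apply/eqP/eq_bigr => j _.
rewrite !coef_map coef_poly ltn_ord /=; case: eqP => [jn|/eqP jn].
  rewrite rmorph1 mul1r exprMn jn mulrA; congr (_ * _).
  by rewrite -[p`_n]/(p`_(size p).-1) -lead_coefE -exprSr prednK.
have jlt : (j < n)%N by have := ltn_ord j; lia.
rewrite exprMn rmorphM rmorphXn /= -(subnK (_ : j <= n.-1)%N); last by lia.
by rewrite addnK exprD; ring.
Qed.
End IntegralMultiple.

(** Here z is 1/e. Multiplying a monic equation of degree n for c/e by e^n leaves c^n plus terms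
    divisible by e. *)
Lemma integral_quotient (D : idomainType) (F : comNzRingType)
    (i : {rmorphism D -> F}) (c e : D) (z : F) :
  injective i -> i e * z = 1 -> integralOver i (i c * z) ->
  exists k w, c ^+ k = e * w.
Proof.
move=> i_inj ez [q /monicP qm /rootP qz].
pose n := (size q).-1.
have sq : (size q <= n.+1)%N by rewrite /n; case: (size q).
have nz k : (k <= n)%N -> i e ^+ n * z ^+ k = i e ^+ (n - k).
  by move=> kn; rewrite -(subnK kn) exprD -mulrA -exprMn ez expr1n mulr1 addnK.
exists n, (- \sum_(j < n) q`_j * c ^+ j * e ^+ (n - j).-1).
apply: i_inj; apply/eqP; rewrite mulrN rmorphN /= -subr_eq0 opprK addrC.
apply/eqP; rewrite -[RHS](mulr0 (i e ^+ n)) -[in RHS]qz.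
rewrite (horner_coef_wide _ (_ : _ <= n.+1)%N); last first.
  exact: leq_trans (size_poly _ _) sq.
rewrite big_ord_recr /= mulrDr !coef_map /= -[q`_n]/(lead_coef q) qm rmorph1.
rewrite mul1r exprMn mulrCA nz // subnn mulr1 rmorphXn; congr (_ + _).
rewrite rmorphM /= rmorph_sum !mulr_sumr; apply: eq_bigr => j _.
rewrite coef_map /= exprMn [RHS]mulrCA [_ * (_ * z ^+ _)]mulrCA nz; last first.
  exact: ltnW.
have -> : (n - j = (n - j).-1.+1)%N by have := ltn_ord j; lia.
by rewrite exprS !rmorphM !rmorphXn /=; ring.
Qed.

(** The conclusion says Frac(D) = D[1/d]. A transcendental generator would give D[X] this property,
    against [poly_not_Goldman]. If all generators are algebraic, d clears their leading
    coefficients, every element becomes integral after multiplication by a power of d, and this is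
    applied to 1/e. *)
Lemma Zariski_Goldman n : forall (D : idomainType) (F : comNzRingType)
    (i : {rmorphism D -> F}) (bs : seq F),
  (size bs <= n)%N -> injective i ->
  (forall y : F, y != 0 -> exists z, y * z = 1) -> generated_over i bs ->
  exists2 d : D, d != 0 & forall e, e != 0 -> exists k w, d ^+ k = e * w.
Proof.
elim: n => [|n IH] D F i bs sbs i_inj Finv gen.
  exists 1; first exact: oner_neq0.
  move=> e e0; have ie0 : i e != 0 by rewrite raddf_eq0.
  have [z ez] := Finv _ ie0.
  have [w wz] : exists w, i w = z.
    apply: (gen z (fun y => exists w, i w = y)) => [x|b||].
    - by exists x.
    - by case: (bs) sbs.
    - by move=> _ _ [x <-] [y <-]; exists (x + y); rewrite rmorphD.
    - by move=> _ _ [x <-] [y <-]; exists (x * y); rewrite rmorphM.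
  exists 0%N, w; rewrite expr0; apply: i_inj.
  by rewrite rmorph1 rmorphM /= wz ez.
(* Injectivity of [adjoin i b] means that b is transcendental over D; it becomes the variable of the
   new base ring D[X]. *)
have [[b bbs b_inj]|nalg] :=
    pselect (exists2 b, b \in bs & injective (adjoin i b)).
  have gen' : generated_over (adjoin i b) (rem b bs).
    apply: generated_over_adjoin gen => c.
    by rewrite (perm_mem (perm_to_rem bbs)) inE => /predU1P.
  have srem : (size (rem b bs) <= n)%N by rewrite size_rem // -ltnS prednK //; case: (bs) bbs.
  by have [d /poly_not_Goldman] := IH _ _ _ _ srem b_inj Finv gen'.
have int_mul b : b \in bs -> exists2 l : D, l != 0 & integralOver i (i l * b).
  move=> bbs; have [p [p0 pb]] : exists p, p != 0 /\ adjoin i b p = 0.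
    apply: contrapT => np; apply: nalg; exists b => //; apply: raddf_inj.
    by move=> p pb; apply/eqP; apply: contrapT => /negP p0; apply: np; exists p.
  exact: algebraic_integral_multiple p0 pb.
have [d [d0 dbs]] : exists d : D, d != 0 /\ {in bs, forall b, integralOver i (i d * b)}.
  elim: (bs) int_mul => [|b cs IHcs] int_mul.
    by exists 1; split; [apply: oner_neq0|].
  have [|d [d0 dcs]] := IHcs.
    by move=> c ccs; apply: int_mul; rewrite inE ccs orbT.
  have [l l0 lb] := int_mul b (mem_head _ _).
  exists (d * l); rewrite mulf_neq0 //; split=> // c.
  rewrite rmorphM /= inE => /predU1P[->|/dcs cint].
    by rewrite -mulrA; apply: integral_mul => //; apply: integral_id.
  by rewrite mulrAC mulrC; apply: integral_mul => //; apply: integral_id.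
have dint y : exists k, integralOver i (i (d ^+ k) * y).
  apply: (gen y (fun y => exists k, integralOver i (i (d ^+ k) * y))).
  - by move=> x; exists 0%N; rewrite -rmorphM; apply: integral_id.
  - by move=> b /dbs; exists 1%N.
  - move=> x z [k xk] [m zm]; exists (k + m)%N.
    rewrite exprD rmorphM /= mulrDr; apply: integral_add.
      by rewrite mulrAC mulrC; apply: integral_mul => //; apply: integral_id.
    by rewrite -mulrA; apply: integral_mul => //; apply: integral_id.
  - move=> x z [k xk] [m zm]; exists (k + m)%N.
    by rewrite exprD rmorphM /= mulrACA; apply: integral_mul.
exists d => // e e0; have ie0 : i e != 0 by rewrite raddf_eq0.
have [z ez] := Finv _ ie0; have [k zk] := dint z.
have [m [w dw]] := integral_quotient i_inj ez zk.
by exists (k * m)%N, w; rewrite exprM.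
Qed.

Lemma maximal_ideal_inv (R : comNzRingType) (P : prime_idealr R) (x : R) :
  maximal_ideal P -> x \notin P -> exists y, 1 - x * y \in P.
Proof.
case=> _ Pmax xP; have idP := prime_ideal P; have [P0 PD PM] := idP.
pose I z := exists y, z - x * y \in P.
have idI : is_ideal I.
  split=> [|z t [y zy] [y' ty]|a z [y zy]]; first by exists 0; rewrite mulr0 subr0.
    exists (y + y'); have -> : z + t - x * (y + y') = z - x * y + (t - x * y').
      by ring.
    exact: PD.
  exists (a * y); have -> : a * z - x * (a * y) = a * (z - x * y) by ring.
  exact: PM.
apply: contrapT => I1; have /Pmax sub := ideal_idealr_closed idI I1.
have xI : x \in (fun z => `[< I z >] : bool).
  by apply/asboolP; exists 1; rewrite mulr1 subrr.
move: xP; rewrite -sub ?xI // => z Pz.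
by apply/asboolP; exists 0; rewrite mulr0 subr0.
Qed.

(** If x were transcendental over K modulo P, the field R/P would be finitely generated over K[X],
    contradicting [Zariski_Goldman] and [poly_not_Goldman]. *)
Lemma Nullstellensatz (K : fieldType) (R : comNzRingType)
    (i : {rmorphism K -> R}) (bs : seq R) (P : prime_idealr R) (x : R) :
  generated_over i bs -> maximal_ideal P ->
  exists2 f : {poly K}, f != 0 & adjoin i x f \in P.
Proof.
move=> gen maxP; pose F : comNzRingType := {ideal_quot P}.
pose pi : {rmorphism R -> F} := \pi_F.
have pi0 y : (pi y == 0) = (y \in P).
  by rewrite -(rmorph0 pi) /= /pi -Quotient.idealrBE subr0.
have pi_surj z : exists y, pi y = z by exists (repr z); apply: reprK.
pose i' : {rmorphism K -> F} := pi \o i.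
have genF : generated_over i' (map pi bs).
  move=> z Q Qi Qb QD QM; have [y <-] := pi_surj z.
  apply: (gen y (fun y => Q (pi y))) => // [b bbs|u v Qu Qv|u v Qu Qv].
  - exact/Qb/map_f.
  - by rewrite rmorphD; apply: QD.
  - by rewrite rmorphM; apply: QM.
have Finv (z : F) : z != 0 -> exists t, z * t = 1.
  have [y <-] := pi_surj z; rewrite pi0 => /(maximal_ideal_inv maxP)[t yt].
  exists (pi t); apply/eqP; rewrite eq_sym -subr_eq0.
  by rewrite -rmorphM -(rmorph1 pi) -rmorphB pi0.
have adjE f : pi (adjoin i x f) = adjoin i' (pi x) f.
  by rewrite !adjoinE -horner_map -map_poly_comp.
have [i_inj|ninj] := pselect (injective (adjoin i' (pi x))).
  have gen' : generated_over (adjoin i' (pi x)) (map pi bs).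
    by apply: generated_over_adjoin genF => c; right.
  have [d d0 Gd] := Zariski_Goldman (leqnn _) i_inj Finv gen'.
  by case: (poly_not_Goldman d0 Gd).
apply: contrapT => nf; apply: ninj; apply: raddf_inj => f fx.
apply/eqP; apply: contrapT => /negP f0; apply: nf; exists f => //.
by rewrite -pi0 adjE fx.
Qed.

(** * Regular sequences and chains of primes *)

Section PrimeAvoiding.
Variables (R : comNzRingType) (J S : R -> Prop).
Hypotheses (idJ : is_ideal J) (S1 : S 1).
Hypothesis SM : forall x y, S x -> S y -> S (x * y).
Hypothesis JS : forall x, J x -> ~ S x.

(** An ideal maximal among those containing J and disjoint from the multiplicative set S is prime:
    if x and y lie outside it, adjoining either one meets S, and the product of the two elements met
    shows that xy lies outside too. *)
Lemma prime_avoiding_exists :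
  exists P : prime_idealr R, (forall x, J x -> x \in P) /\ forall x, x \in P -> ~ S x.
Proof.
pose good (A : set R) := [/\ is_ideal A, (J `<=` A)%classic & forall x, A x -> ~ S x].
have Jgood : good J by split.
have [A [PA maxA]] :
    exists A, (A = set0 \/ good A) /\ forall B, (A `<` B)%classic -> ~ (B = set0 \/ good B).
  apply: (@Zorn_bigcup R (fun A => A = set0 \/ good A)) => F FP totF.
  have [[G [FG gG]]|nG] := pselect (exists G, F G /\ good G); last first.
    left; rewrite -subset0 => x [G FG Gx]; case: (FP G FG) => [G0|gG].
      by rewrite G0 in Gx.
    by case: nG; exists G.
  have [[G0 _ _] JG _] := gG.
  have nice B x : F B -> B x -> good B.
    by move=> FB Bx; case: (FP B FB) => // B0; rewrite B0 in Bx.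
  right; split; last 2 first.
  - by move=> x Jx; exists G => //; apply: JG.
  - by move=> x [B FB Bx]; have [_ _] := nice B x FB Bx; apply.
  split; first by exists G.
  - move=> x y [B FB Bx] [C FC Cy].
    have [[_ BD _] _ _] := nice B x FB Bx; have [[_ CD _] _ _] := nice C y FC Cy.
    case: (totF B C FB FC) => sub; first by exists C => //; apply: CD => //; apply: sub.
    by exists B => //; apply: BD => //; apply: sub.
  - by move=> a x [B FB Bx]; have [[_ _ BM] _ _] := nice B x FB Bx; exists B => //; apply: BM.
have {PA} [idA JA AS] : good A.
  case: PA => // A0; case: (maxA J); last by right.
  rewrite A0; split; first by move=> x [].
  by case: idJ => J0 _ _ /(_ 0 J0).
have [A0 AD AM] := idA.
have ext x : ~ A x -> exists a r, A a /\ S (a + r * x).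
  move=> nAx; pose B z := exists a r, A a /\ z = a + r * x.
  apply: contrapT => nS; apply: (maxA B).
    split=> [z Az|/(_ x)]; first by exists z, 0; rewrite mul0r addr0.
    by move=> BA; apply/nAx/BA; exists 0, 1; rewrite mul1r add0r.
  right; split.
  - split; first by exists 0, 0; rewrite mul0r addr0.
      move=> _ _ [a [r [Aa ->]]] [b [t [Ab ->]]].
      by exists (a + b), (r + t); split; [apply: AD|ring].
    move=> c _ [a [r [Aa ->]]].
    by exists (c * a), (c * r); split; [apply: AM|ring].
  - by move=> z /JA Az; exists z, 0; rewrite mul0r addr0.
  - by move=> z [a [r [Aa ->]]] Sz; apply: nS; exists a, r.
have [|x y Axy|P PE] := prime_idealr_exists idA.
- by move=> A1; apply: AS A1 S1.
- apply: contrapT => /not_orP[/ext[a [r [Aa Sa]]] /ext[b [t [Ab Sb]]]].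
  apply: AS (SM Sa Sb).
  have -> : (a + r * x) * (b + t * y) =
    (b + t * y) * a + (r * x * b + r * t * (x * y)) by ring.
  by apply: (AD); [apply: AM|apply: AD; apply: AM].
by exists P; split=> x; rewrite PE; [apply: JA|apply: AS].
Qed.
End PrimeAvoiding.

(** Properness of the generated ideal is left out here; it is obtained after localizing at a prime
    that contains s. *)
Definition weakly_regular (R : comNzRingType) (s : seq R) : Prop :=
  forall i, (i < size s)%N -> forall y : R,
    ideal_gen (take i s) (s`_i * y) -> ideal_gen (take i s) y.

Lemma weakly_regular_rcons (R : comNzRingType) (s : seq R) (x : R) :
  weakly_regular (rcons s x) <->
  weakly_regular s /\ forall y, ideal_gen s (x * y) -> ideal_gen s y.
Proof.
split=> [reg|[reg regx] i].
  split=> [i il y|y]; last first.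
    have := reg (size s); rewrite size_rcons => /(_ (leqnn _)) /(_ y).
    by rewrite nth_rcons ltnn eqxx -cats1 take_size_cat.
  have := reg i; rewrite size_rcons (leqW il) => /(_ isT) /(_ y).
  by rewrite nth_rcons il -cats1 takel_cat // ltnW.
rewrite size_rcons ltnS leq_eqVlt => /predU1P[->|il] y.
  by rewrite nth_rcons ltnn eqxx -cats1 take_size_cat //; apply: regx.
by rewrite nth_rcons il -cats1 takel_cat ?(ltnW il) //; apply: reg.
Qed.

Definition strict_sub (R : comNzRingType) (p q : prime_idealr R) : Prop :=
  {subset p <= q} /\ ~ {subset q <= p}.

Lemma strict_sub_trans (R : comNzRingType) (p q r : prime_idealr R) :
  strict_sub p q -> {subset q <= r} -> strict_sub p r.
Proof.
move=> [pq nqp] qr; split=> [x /pq/qr //|rp].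
by apply: nqp => x /qr/rp.
Qed.

(** The chain is built downwards from q, dropping the last element x of the sequence at each stage:
    regularity of x modulo the others gives a prime below q that contains them but not x. *)
Lemma weakly_regular_chain (R : comNzRingType) (s : seq R) (q : prime_idealr R) :
  weakly_regular s -> {subset s <= q} ->
  exists2 p : nat -> prime_idealr R, p (size s) = q &
    forall i j, (i < j)%N -> (j <= size s)%N -> strict_sub (p i) (p j).
Proof.
elim/last_ind: s q => [|s x IH] q.
  by exists (fun=> q) => // i j ij; rewrite leqn0; case: j ij.
move=> /weakly_regular_rcons[reg regx] sq.
(* Avoiding the elements outside q keeps the new prime inside q; avoiding x makes the inclusion
   strict. *)
pose S z := exists t k, t \notin q /\ z = t * x ^+ k.
have [||||q' [sq' q'S]] := @prime_avoiding_exists R (ideal_gen s) S.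
- exact: ideal_gen_ideal.
- by exists 1, 0%N; rewrite idealr1 mulr1.
- move=> _ _ [t [k [tq ->]]] [u [m [uq ->]]]; exists (t * u), (k + m)%N.
  by rewrite prime_idealrM negb_or tq uq exprD; split=> //; ring.
- move=> z sz [t [k [tq zE]]]; move: sz; rewrite {}zE.
  elim: k => [|k IHk]; last first.
    by rewrite exprS mulrCA => /regx.
  rewrite mulr1 => st; move: tq => /negP; apply.
  apply: (ideal_gen_min (prime_ideal q)) st.
  by move=> y ys; apply: sq; rewrite mem_rcons inE ys orbT.
have q'q : strict_sub q' q.
  split=> [t /q'S nSt|qq'].
    by apply: contrapT => /negP tq; apply: nSt; exists t, 0%N; rewrite mulr1.
  have /qq'/q'S : x \in q by apply: sq; rewrite mem_rcons mem_head.
  by apply; exists 1, 1%N; rewrite idealr1 expr1 mul1r.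
have [y ys|p pq' pP] := IH q' reg; first exact/sq'/ideal_gen_mem.
exists (fun j => if (j <= size s)%N then p j else q).
  by rewrite size_rcons ltnn.
move=> i j ij; rewrite size_rcons leq_eqVlt => /predU1P[jE|js]; last first.
  by rewrite ltnS in js; rewrite js (leq_trans (ltnW ij) js); apply: pP.
rewrite jE ltnn; have is' : (i <= size s)%N by rewrite -ltnS -jE.
rewrite is'; move: is'; rewrite leq_eqVlt => /predU1P[->|is']; first by rewrite pq'.
by apply: strict_sub_trans (pP i _ is' (leqnn _)) _; rewrite pq'; case: q'q.
Qed.

Lemma regular_sequence_chain (R : comNzRingType) (s : seq R) :
  regular_sequence s ->
  exists p : 'I_(size s).+1 -> prime_idealr R, prime_chain p.
Proof.
case=> reg s1.
have [||||q [sq _]] := @prime_avoiding_exists R (ideal_gen s) (fun z => z = 1).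
- exact: ideal_gen_ideal.
- by [].
- by move=> _ _ -> ->; rewrite mulr1.
- by move=> x sx x1; rewrite x1 in sx.
have [x xs|p _ pP] := @weakly_regular_chain R s q reg; first exact/sq/ideal_gen_mem.
by exists (fun i => p i) => i j ij; apply: pP => //; rewrite -ltnS.
Qed.

Definition krull_dim_le (R : comNzRingType) (n : nat) : Prop :=
  forall k (p : 'I_k.+1 -> prime_idealr R), prime_chain p -> (k <= n)%N.

(* The depth never exceeds the dimension, since a regular sequence produces a
   chain of primes of the same length. *)
Lemma cohen_macaulay_local_criterion (R : comNzRingType) (M : {pred R}) n
    (s : seq R) :
  noetherian R -> local_ring_with M -> krull_dim_le R n ->
  regular_sequence s -> {subset s <= M} -> size s = n -> cohen_macaulay_local R.
Proof.
move=> noethR locM dimn regs sM ss; split=> //; exists M; split=> //; exists n.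
split; split=> //; first by exists s.
- by move=> t /regular_sequence_chain[p /dimn].
- by rewrite -ss; apply: regular_sequence_chain.
Qed.

(** * Localization *)

Section LocalizationTheory.
Variables (R : comNzRingType) (P : prime_idealr R).
Local Notation L := (localization P).

Definition loc_map (x : R) : L := \pi_L ((x, loc_denom1 P) : loc_frac P).

Lemma pi_locD (x y : loc_frac P) : \pi_L x + \pi_L y = \pi_L (loc_add_frac x y).
Proof. exact: pi_loc_add. Qed.

Lemma pi_locM (x y : loc_frac P) : \pi_L x * \pi_L y = \pi_L (loc_mul_frac x y).
Proof. exact: pi_loc_mul. Qed.

Lemma loc_map_eq x y :
  loc_map x = loc_map y <-> exists2 u, u \notin P & u * x = u * y.
Proof.
split=> [/eqP/loc_eqP[u /=]|[u uP e]].
  by rewrite !mulr1 => e; exists (den u) => //; apply: denP.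
by apply/eqP/loc_eqP; exists (LocDenom uP); rewrite /= !mulr1.
Qed.

Lemma loc_map_is_zmod_morphism : zmod_morphism loc_map.
Proof.
move=> x y; apply: (addIr (loc_map y)); rewrite subrK [LHS]pi_locD.
by apply/eqP/loc_eqP; exists (loc_denom1 P) => /=; ring.
Qed.

Lemma loc_map_is_monoid_morphism : monoid_morphism loc_map.
Proof.
split=> // x y; rewrite [RHS]pi_locM.
by apply/eqP/loc_eqP; exists (loc_denom1 P) => /=; ring.
Qed.

HB.instance Definition _ :=
  GRing.isZmodMorphism.Build R L loc_map loc_map_is_zmod_morphism.
HB.instance Definition _ :=
  GRing.isMonoidMorphism.Build R L loc_map loc_map_is_monoid_morphism.

Lemma loc_fracP (z : L) :
  exists x s, s \notin P /\ z * loc_map s = loc_map x.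
Proof.
elim/quotW: z => -[x [s sP]]; exists x, s; split=> //.
by rewrite [LHS]pi_locM; apply/eqP/loc_eqP; exists (loc_denom1 P) => /=; ring.
Qed.

Lemma loc_map_inv s : s \notin P -> exists z, loc_map s * z = 1.
Proof.
move=> sP; exists (\pi_L ((1, LocDenom sP) : loc_frac P)); rewrite [LHS]pi_locM.
by apply/eqP/loc_eqP; exists (loc_denom1 P) => /=; ring.
Qed.

Lemma loc_cancel (I : L -> Prop) s z :
  is_ideal I -> s \notin P -> I (z * loc_map s) -> I z.
Proof.
move=> [_ _ IM] /loc_map_inv[t st] Iz.
by rewrite -[z]mulr1 -st mulrA mulrC; apply: IM.
Qed.

(** The elements that some denominator brings into the image of (s) form an ideal of the
    localization; it contains the generators, hence the extended ideal. *)
Lemma loc_ideal_gen s x :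
  ideal_gen (map loc_map s) (loc_map x) <->
  exists2 u, u \notin P & ideal_gen s (u * x).
Proof.
have idL := ideal_gen_ideal (map loc_map s); have [_ _ LM] := idL.
have idR := ideal_gen_ideal s; have [R0 RD RM] := idR.
split=> [Lx|[u uP [c e]]]; last first.
  apply: (loc_cancel idL uP); rewrite mulrC -rmorphM /= e rmorph_sum.
  apply: is_ideal_sum => // j _ _; rewrite rmorphM; apply: LM.
  exact/ideal_gen_mem/map_f/mem_nth.
pose I z := exists u y, [/\ u \notin P, ideal_gen s y & z * loc_map u = loc_map y].
have idI : is_ideal I.
  split=> [|z t [u [y [uP sy zu]]] [v [w [vP sw tv]]]|a z [u [y [uP sy zu]]]].
  - by exists 1, 0; rewrite idealr1 mul0r rmorph0.
  - exists (u * v), (v * y + u * w); rewrite prime_idealrM negb_or uP vP.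
    split=> //; first by apply: (RD); apply: RM.
    by rewrite rmorphD !rmorphM /= -zu -tv; ring.
  - have [b [v [vP av]]] := loc_fracP a; exists (u * v), (b * y).
    rewrite prime_idealrM negb_or uP vP; split=> //; first exact: RM.
    by rewrite !rmorphM /= -zu -av; ring.
have [u [y [uP sy]]] : I (loc_map x).
  apply: ideal_gen_min Lx => // _ /mapP[y ys ->]; exists 1, y.
  by rewrite idealr1 rmorph1 mulr1; split=> //; apply: ideal_gen_mem.
rewrite -rmorphM => /loc_map_eq[v vP e]; exists (v * u).
  by rewrite prime_idealrM negb_or uP vP.
by rewrite -mulrA (mulrC u) e; apply: RM.
Qed.

Lemma noetherian_localization : noetherian R -> noetherian L.
Proof.
move=> /noetherianP noethR; apply/noetherianP => J idJ; have [J0 JD JM] := idJ.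
have idI : is_ideal (fun x => J (loc_map x)).
  split=> [|x y|a x]; rewrite ?rmorph0 ?rmorphD ?rmorphM //; first exact: JD.
  exact: JM.
have [s sP] := noethR _ idI; exists (map loc_map s) => z; split=> [Jz|].
  have [x [t [tP e]]] := loc_fracP z.
  apply: (loc_cancel (ideal_gen_ideal _) tP); rewrite e.
  apply/loc_ideal_gen; exists 1; first by rewrite idealr1.
  by rewrite mul1r; apply/sP; rewrite -e mulrC; apply: JM.
apply: ideal_gen_min => // _ /mapP[x xs ->]; apply/sP.
exact: ideal_gen_mem.
Qed.

Section Extension.
Variable Q : prime_idealr R.
Hypothesis QP : {subset Q <= P}.

(** The prime consists of the fractions with numerator in Q; no denominator lies in Q, because Q is
    contained in P. *)
Lemma loc_prime_exists :
  exists Q' : prime_idealr L, forall x, (loc_map x \in Q') = (x \in Q).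
Proof.
pose I z := exists x s, [/\ x \in Q, s \notin P & z * loc_map s = loc_map x].
have sQ s : s \notin P -> s \notin Q by apply: contraNN => /QP.
have IE x : I (loc_map x) -> x \in Q.
  move=> [y [s [yQ sP]]]; rewrite -rmorphM => /loc_map_eq[u uP e].
  have : u * (x * s) \in Q by rewrite e idealMr.
  by rewrite !prime_idealrM (negPf (sQ _ uP)) (negPf (sQ _ sP)) orbF.
have idI : is_ideal I.
  split=> [|z t [x [s [xQ sP zs]]] [y [r [yQ rP tr]]]|a z [x [s [xQ sP zs]]]].
  - by exists 0, 1; rewrite idealr0 idealr1 mul0r rmorph0.
  - exists (r * x + s * y), (s * r); rewrite (prime_idealrM P s r) negb_or sP rP.
    by rewrite rpredD ?idealMr // rmorphD !rmorphM /= -zs -tr; split=> //; ring.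
  - have [b [r [rP ar]]] := loc_fracP a; exists (b * x), (s * r).
    rewrite (prime_idealrM P s r) negb_or sP rP idealMr // !rmorphM /= -zs -ar.
    by split=> //; ring.
have [|z t|Q' Q'E] := prime_idealr_exists idI.
- by rewrite -(rmorph1 loc_map) => /IE; rewrite idealr1.
- have [x [s [sP zs]]] := loc_fracP z; have [y [r [rP tr]]] := loc_fracP t.
  move=> Izt; have [_ _ IM] := idI.
  have : I (loc_map (x * y)).
    have -> : loc_map (x * y) = loc_map s * loc_map r * (z * t).
      by rewrite rmorphM /= -zs -tr; ring.
    exact: IM.
  move/IE; rewrite prime_idealrM => /orP[xQ|yQ].
    by left; exists x, s.
  by right; exists y, r.
exists Q' => x; apply/idP/idP => [/Q'E/IE //|xQ].
by apply/Q'E; exists x, 1; rewrite idealr1 rmorph1 mulr1.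
Qed.
End Extension.

(** M is the extension of P; a fraction with numerator outside P is a unit, so every proper ideal
    lies in M. *)
Lemma loc_local : exists M : prime_idealr L,
  local_ring_with M /\ forall x, (loc_map x \in M) = (x \in P).
Proof.
have [M ME] := @loc_prime_exists P (fun _ => id).
have closedM := prime_idealr_idealr_closed M.
have sub (I : {pred L}) : idealr_closed I -> {subset I <= M}.
  move=> idI z Iz; have [x [s [sP zs]]] := loc_fracP z.
  apply: (loc_cancel (prime_ideal M) sP); rewrite zs ME.
  apply: contrapT => /negP/loc_map_inv[t xt].
  have [_ /negP I1 _] := idI; apply: I1; rewrite -xt -zs.
  have [_ _ IM] := idealr_closed_ideal idI.
  by rewrite mulrC [z * _]mulrC; do 2!apply: (IM).
exists M; split=> //; split=> [|N [idN maxN]].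
  split=> // I /sub IM MI z; apply/idP/idP; [exact: IM|exact: MI].
by move=> z; rewrite (maxN M) //; apply: sub.
Qed.

(** Contraction preserves strict inclusions, because denominators are units and an ideal of the
    localization is determined by its contraction. *)
Lemma krull_dim_le_localization n : krull_dim_le R n -> krull_dim_le L n.
Proof.
move=> dimR k p chp.
have /choice[q qE] (i : 'I_k.+1) :
    exists q : prime_idealr R, forall x, (x \in q) <-> (loc_map x \in p i).
  apply: prime_idealr_exists.
  - split=> [|x y|a x]; rewrite ?rmorph0 ?rmorphD ?rmorphM ?idealr0 //.
      exact: rpredD.
    exact: idealMr.
  - by rewrite rmorph1 idealr1.
  - by move=> x y; rewrite rmorphM prime_idealrM => /orP.
apply: (dimR k q) => i j /chp[pij npij]; split=> [x /qE/pij/qE //|qji].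
apply: npij => z pjz; have [x [s [sP zs]]] := loc_fracP z.
apply: (loc_cancel (prime_ideal (p i)) sP); rewrite zs; apply/qE/qji/qE.
by rewrite -zs mulrC idealMr.
Qed.

Lemma regular_sequence_localization s :
  weakly_regular s -> {subset s <= P} -> regular_sequence (map loc_map s).
Proof.
move=> reg sP; split=> [i|].
  rewrite size_map => ilt z; rewrite -map_take (nth_map 0) // => Lz.
  have [x [t [tP zt]]] := loc_fracP z.
  apply: (loc_cancel (ideal_gen_ideal _) tP); rewrite zt; apply/loc_ideal_gen.
  have : ideal_gen (map loc_map (take i s)) (loc_map (s`_i * x)).
    rewrite rmorphM /= -zt mulrA mulrC.
    by case: (ideal_gen_ideal (map loc_map (take i s))) => _ _; apply.
  by case/loc_ideal_gen=> u uP; rewrite mulrCA => /(reg _ ilt); exists u.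
rewrite -(rmorph1 loc_map) => /loc_ideal_gen[u /negP uP]; rewrite mulr1 => su.
by apply: uP; apply: (ideal_gen_min (prime_ideal P)) su.
Qed.
End LocalizationTheory.

Lemma cohen_macaulay_criterion (R : comNzRingType) n :
  noetherian R -> krull_dim_le R n ->
  (forall P : prime_idealr R, maximal_ideal P ->
     exists s : seq R, [/\ weakly_regular s, {subset s <= P} & size s = n]) ->
  cohen_macaulay R.
Proof.
move=> noethR dimR regR; split=> // P /regR[s [reg sP ss]].
have [M [locM ME]] := loc_local P.
apply: (cohen_macaulay_local_criterion (s := map (loc_map P) s) _ locM).
- exact: noetherian_localization.
- exact: krull_dim_le_localization dimR.
- exact: regular_sequence_localization.
- by move=> _ /mapP[x /sP xP ->]; rewrite ME.
- by rewrite size_map.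
Qed.

(* In the hypothesis x' and y' stand for b x and b y, where b is an element
   of a larger ring such that b P is contained in R. *)
Lemma not_cohen_macaulay_criterion (R : comNzRingType) (Q0 Q1 P : prime_idealr R) :
  maximal_ideal P -> strict_sub Q0 Q1 -> strict_sub Q1 P ->
  (forall x y, x \in P -> y \in P -> exists x' y', x' * y = x * y' /\
     forall u c, u \notin P -> u * x' = x * c -> x = 0) ->
  ~ cohen_macaulay R.
Proof.
move=> maxP Q01 Q1P bP [_ /(_ P maxP)[_ [M [locM [n [[[s [[reg s1] sM ss] _] [_ dimn]]]]]]]].
have [M' [locM' M'E]] := loc_local P.
have {sM} sM x : x \in s -> x \in M'.
  by move=> /sM; case: locM locM' => _ uniqM [maxM' _]; rewrite (uniqM _ maxM').
have [Q1sP _] := Q1P; have [Q0sQ1 _] := Q01.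
have Q0sP : {subset Q0 <= P} by move=> x /Q0sQ1/Q1sP.
(* The chain Q0 < Q1 < P extends to the localization, so its dimension is at least 2. *)
have n2 : (2 <= n)%N.
  have [Q0' Q0E] := loc_prime_exists Q0sP.
  have [Q1' Q1E] := loc_prime_exists Q1sP.
  have strict (q r : prime_idealr R) (q' r' : prime_idealr (localization P)) :
      (forall x, (loc_map P x \in q') = (x \in q)) ->
      (forall x, (loc_map P x \in r') = (x \in r)) ->
      strict_sub q r -> strict_sub q' r'.
    move=> qE rE [qr nrq]; split=> [z qz|rq].
      have [x [t [tP zt]]] := loc_fracP z.
      apply: (loc_cancel (prime_ideal r') tP); rewrite zt rE; apply: qr.
      by rewrite -qE -zt mulrC idealMr.
    by apply: nrq => x; rewrite -rE -qE; apply: rq.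
  have s01 := strict _ _ _ _ Q0E Q1E Q01.
  have s1M := strict _ _ _ _ Q1E M'E Q1P.
  have s0M := strict_sub_trans s01 (proj1 s1M).
  apply: (dimn 2 (fun i => if val i == 0%N then Q0' else
                           if val i == 1%N then Q1' else M')).
  by move=> [[|[|[|i]]] ilt] [[|[|[|j]]] jlt].
have {ss n2} : (1 < size s)%N by rewrite ss.
case: s reg s1 sM => [//|a [//|b s]] reg s1 sM _.
(* x and y are numerators, both in P, of the first two elements a and b of the regular sequence. *)
have [x [t [tP xa]]] := loc_fracP a; have [y [r [rP yb]]] := loc_fracP b.
have [_ _ MM] := prime_ideal M'.
have xP : x \in P by rewrite -M'E -xa mulrC MM // sM // mem_head.
have yP : y \in P by rewrite -M'E -yb mulrC MM // sM // !inE eqxx orbT.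
have [x' [y' [xy x0]]] := bP x y xP yP.
have ida := ideal_gen_ideal [:: a]; have [_ _ aM] := ida.
have := reg 1%N isT (loc_map P x'); rewrite /= => rega.
(* Up to units, x' y = x y' makes b x' a multiple of a; regularity of b modulo a puts x' in (a). *)
have {rega} : ideal_gen [:: a] (loc_map P x').
  apply/rega/(loc_cancel ida rP).
  have -> : b * loc_map P x' * loc_map P r = loc_map P y' * loc_map P t * a.
    by rewrite mulrAC yb -rmorphM mulrC xy rmorphM /= -xa; ring.
  by apply/aM/ideal_gen_mem/mem_head.
case/(ideal_gen_rcons [::]) => z [_ [/ideal_gen_nil -> ]]; rewrite add0r.
have [c [v [vP cz]]] := loc_fracP z.
move=> /(congr1 (fun w => w * loc_map P (t * v))).
have -> : z * a * loc_map P (t * v) = loc_map P (c * x).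
  by rewrite !rmorphM /= -cz -xa; ring.
rewrite -rmorphM => /loc_map_eq[u uP e].
have {}x0 : x = 0.
  apply: (x0 (u * (t * v)) (u * c)).
    by rewrite !prime_idealrM !negb_or uP tP vP.
  by rewrite -mulrA [t * v * _]mulrC e; ring.
have a0 : a = 0.
  have [w tw] := loc_map_inv tP.
  by rewrite -[a]mulr1 -tw mulrA xa x0 rmorph0 mul0r.
have := reg 0%N isT 1; rewrite /= a0 mul0r => /(_ _)/ideal_gen_nil.
by move=> /(_ (proj2 (ideal_gen_nil _) erefl))/eqP; rewrite oner_eq0.
Qed.

(** * Monoid algebras *)

Section MonoidAlgebraTheory.
Variables (K : fieldType) (M : nmodType).
Local Notation A := (monoid_algebra K M).

Definition monom (c : K) (a : M) : A := << c *g a >>.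

Lemma monomM c d a b : monom c a * monom d b = monom (c * d) (a + b).
Proof. exact: ma_mulUU. Qed.

Lemma monom10 : monom 1 0 = 1. Proof. by []. Qed.

Lemma monom0 a : monom 0 a = 0. Proof. exact: monalgU0. Qed.

Lemma monoid_algebra_sum (f : A) : f = \sum_(a <- msupp f) monom f@_a a.
Proof. exact: monalgE. Qed.

Lemma monoid_algebra_supp_ind (Q : A -> Prop) :
  Q 0 -> (forall f g, Q f -> Q g -> Q (f + g)) ->
  forall f : A, (forall a, f@_a != 0 -> Q (monom f@_a a)) -> Q f.
Proof.
move=> Q0 QD f Qm; rewrite (monoid_algebra_sum f) big_seq.
by apply: big_ind => // a; rewrite -mcoeff_neq0; apply: Qm.
Qed.

Lemma monoid_algebra_ind (Q : A -> Prop) :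
  Q 0 -> (forall f g, Q f -> Q g -> Q (f + g)) ->
  (forall c a, Q (monom c a)) -> forall f : A, Q f.
Proof. by move=> Q0 QD Qm f; apply: monoid_algebra_supp_ind. Qed.

Lemma mcoeff_monom c a b : (monom c a)@_b = c *+ (a == b).
Proof. exact: mcoeffU. Qed.

Lemma mcoeff_add (f g : A) b : (f + g)@_b = f@_b + g@_b.
Proof. exact: mcoeffD. Qed.

Definition ma_const (c : K) : A := monom c 0.

Lemma ma_const_zmod : zmod_morphism ma_const.
Proof. exact: monalgUB. Qed.

Lemma ma_const_monoid : monoid_morphism ma_const.
Proof. by split=> // c d; rewrite /ma_const monomM addr0. Qed.

HB.instance Definition _ := GRing.isZmodMorphism.Build K A ma_const ma_const_zmod.
HB.instance Definition _ := GRing.isMonoidMorphism.Build K A ma_const ma_const_monoid.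

Lemma ma_const_monom c d a : ma_const c * monom d a = monom (c * d) a.
Proof. by rewrite monomM add0r. Qed.

Section Extension.
Variables (S : comNzRingType) (f : {rmorphism K -> S}) (h : M -> S).

(** For arbitrary h this is only additive, as used for the coordinate maps [chi]; ring morphisms
    come from the multiplicative h of [ma_ext_rmorphism]. *)
Definition ma_ext (g : A) : S := mmap f h g.

Lemma ma_ext_zmod : zmod_morphism ma_ext.
Proof. exact: mmap_is_additive. Qed.

HB.instance Definition _ := GRing.isZmodMorphism.Build A S ma_ext ma_ext_zmod.

Lemma ma_ext_monom c a : ma_ext (monom c a) = f c * h a.
Proof. exact: mmapU. Qed.

Lemma ma_ext_monoid :
  h 0 = 1 -> {morph h : a b / a + b >-> a * b} -> monoid_morphism ma_ext.
Proof.
move=> h0 hD; split; first by rewrite -monom10 ma_ext_monom rmorph1 h0 mulr1.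
move=> u v; elim/monoid_algebra_ind: u => [|u u' IH IH'|c a].
- by rewrite mul0r raddf0 mul0r.
- by rewrite mulrDl !raddfD /= IH IH' mulrDl.
elim/monoid_algebra_ind: v => [|v v' IH IH'|d b].
- by rewrite mulr0 raddf0 mulr0.
- by rewrite mulrDr !raddfD /= IH IH' mulrDr.
by rewrite monomM !ma_ext_monom hD rmorphM /=; ring.
Qed.

Lemma ma_ext_rmorphism :
  h 0 = 1 -> {morph h : a b / a + b >-> a * b} ->
  exists phi : {rmorphism A -> S}, forall c a, phi (monom c a) = f c * h a.
Proof.
move=> h0 hD; pose phi : {rmorphism A -> S} := HB.pack ma_ext
  (GRing.isMonoidMorphism.Build A S ma_ext (ma_ext_monoid h0 hD)).
by exists phi => c a; apply: ma_ext_monom.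
Qed.
End Extension.

Lemma generated_over_monoms (gs : seq M) :
  (forall a (Q : M -> Prop), Q 0 ->
     (forall g x, g \in gs -> Q x -> Q (g + x)) -> Q a) ->
  generated_over ma_const (map (monom 1) gs).
Proof.
move=> gen f Q Qc Qg QD QM.
elim/monoid_algebra_ind: f => [||c a]; first by rewrite -(rmorph0 ma_const).
  exact: QD.
rewrite -[c]mulr1 -ma_const_monom; apply: (QM) => //.
apply: (gen a (fun a => Q (monom 1 a))) => [|g x ggs Qx]; first exact: Qc.
rewrite -[X in monom X _](mulr1 1) -monomM; apply: (QM) => //.
exact/Qg/map_f.
Qed.

Variable deg : M -> nat.
Hypothesis deg0 : deg 0 = 0%N.
Hypothesis degD : forall a b, deg (a + b) = (deg a + deg b)%N.

Definition deg_le (n : nat) (f : A) : Prop :=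
  forall a, f@_a != 0 -> (deg a <= n)%N.

Lemma deg_leD n f g : deg_le n f -> deg_le n g -> deg_le n (f + g).
Proof.
move=> fn gn a; rewrite mcoeff_add; have [->|/fn //] := eqVneq f@_a 0.
by rewrite add0r => /gn.
Qed.

Lemma deg_le_monom n c a : (deg a <= n)%N -> deg_le n (monom c a).
Proof.
by move=> an b; rewrite mcoeff_monom; case: (eqVneq a b) => [<-|] //; rewrite eqxx.
Qed.

Lemma deg_le0 n : deg_le n 0.
Proof. by rewrite -(monom0 0); apply: deg_le_monom; rewrite deg0. Qed.

Lemma deg_leM m n f g : deg_le m f -> deg_le n g -> deg_le (m + n) (f * g).
Proof.
move=> fm gn; apply: (monoid_algebra_supp_ind (Q := fun f => deg_le (m + n) (f * g))).
- by rewrite mul0r; apply: deg_le0.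
- by move=> u v un vn; rewrite mulrDl; apply: deg_leD.
move=> a /fm am; apply: (monoid_algebra_supp_ind (Q := fun g => deg_le _ (_ * g))).
- by rewrite mulr0; apply: deg_le0.
- by move=> u v un vn; rewrite mulrDr; apply: deg_leD.
by move=> b /gn bn; rewrite monomM; apply: deg_le_monom; rewrite degD leq_add.
Qed.

Lemma deg_leX m k f : deg_le m f -> deg_le (k * m) (f ^+ k).
Proof.
move=> fm; elim: k => [|k IH]; last by rewrite exprS mulSn; apply: deg_leM.
by rewrite expr0 -monom10; apply: deg_le_monom; rewrite deg0.
Qed.

Lemma deg_le_mono m n f : (m <= n)%N -> deg_le m f -> deg_le n f.
Proof. by move=> mn fm a /fm /leq_trans; apply. Qed.

Lemma deg_le_exists f : exists n, deg_le n f.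
Proof.
exists (\max_(a <- msupp f) deg a)%N => a fa.
by apply: leq_bigmax_seq => //; rewrite -mcoeff_neq0.
Qed.

(** The coefficient matrix has more rows than columns, so its left kernel is nonzero. *)
Lemma linear_dependence (T : finType) (v : T -> A) (s : seq M) :
  (forall e a, (v e)@_a != 0 -> a \in s) -> (size s < #|T|)%N ->
  exists c : T -> K, (exists e, c e != 0) /\ \sum_e ma_const (c e) * v e = 0.
Proof.
move=> vs sT.
pose V : 'M[K]_(#|T|, size s) := \matrix_(i, j) (v (enum_val i))@_(nth 0 s j).
have : kermx V != 0.
  rewrite -mxrank_eq0 mxrank_ker -lt0n subn_gt0.
  exact: leq_ltn_trans (rank_leq_col V) sT.
case/rowV0Pn=> u /sub_kermxP uV u0.
exists (fun e => u 0 (enum_rank e)); split.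
  apply: contrapT => nc; move/negP: u0; apply; apply/eqP/rowP => i.
  rewrite mxE; apply/eqP; apply: contrapT => /negP ui; apply: nc.
  by exists (enum_val i); rewrite enum_valK.
apply/malgP => a; rewrite raddf_sum /= [RHS]mcoeff0.
have cM c f : (ma_const c * f : A)@_a = c * f@_a.
  elim/monoid_algebra_ind: f => [|f g IH IH'|d b].
  - by rewrite mulr0 [LHS]mcoeff0 [X in _ * X]mcoeff0 mulr0.
  - by rewrite mulrDr !mcoeff_add IH IH' mulrDr.
  - by rewrite ma_const_monom !mcoeff_monom mulrnAr.
under eq_bigr do rewrite cM.
have [|nas] := boolP (a \in s); last first.
  rewrite big1 // => e _; suff /eqP-> : (v e)@_a == 0 by rewrite mulr0.
  by apply: contraNT nas => /vs.
case/(nthP 0) => j jlt <-.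
have /rowP/(_ (Ordinal jlt)) := uV; rewrite !mxE => e0; rewrite -[RHS]e0.
rewrite (reindex (fun i : 'I_#|T| => enum_val i)) /=; last first.
  exact: (onW_bij _ (@enum_val_bij T)).
by apply: eq_bigr => i _; rewrite mxE enum_valK.
Qed.
End MonoidAlgebraTheory.

(** * An upper bound for the Krull dimension *)

Section MonomialsAlongChain.
Variables (K : fieldType) (R : comNzRingType) (i : {rmorphism K -> R}) (N : nat).

(** Exponent vectors are nested pairs, so that the induction along a chain of primes can split off
    the first exponent. *)
Fixpoint exponent (n : nat) : finType :=
  if n is n'.+1 then ('I_N * exponent n')%type : finType else unit : finType.

Fixpoint power_product n (x : nat -> R) : exponent n -> R :=
  match n return exponent n -> R with
  | 0%N => fun=> 1
  | n'.+1 => fun e => x 0%N ^+ e.1 * power_product (fun k => x k.+1) e.2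
  end.

Lemma card_exponent n : #|exponent n| = (N ^ n)%N.
Proof.
by elim: n => [|n IH]; rewrite /= ?card_unit // card_prod card_ord IH expnS.
Qed.

(* Dividing by x_j and passing to p_(j+1) isolates the coefficient of the
   lexicographically smallest monomial, which ends up in the last prime. *)
Lemma chain_independent n (p : nat -> prime_idealr R) (x : nat -> R)
    (c : exponent n -> K) :
  (forall j, (j < n)%N ->
     [/\ {subset p j <= p j.+1}, x j \in p j.+1 & x j \notin p j]) ->
  \sum_e i (c e) * power_product x e \in p 0%N -> forall e, c e = 0.
Proof.
elim: n p x c => [|n IH] p x c xp.
  case=> sum0 []; move: sum0; rewrite (bigD1 tt) //= big1; last by case.
  rewrite addr0 mulr1 => c0; apply/eqP; apply: contrapT => /negP cn0.
  have := idealMr (i (c tt)^-1) c0.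
  by rewrite -rmorphM mulVf // rmorph1 idealr1.
pose f (a : 'I_N) := \sum_e i (c (a, e)) * power_product (fun k => x k.+1) e.
have -> : \sum_e i (c e) * power_product x e = \sum_(a < N) x 0%N ^+ a * f a.
  transitivity (\sum_(a < N) \sum_(e : exponent n)
      i (c (a, e)) * power_product x ((a, e) : exponent n.+1)).
    by rewrite pair_bigA; apply: eq_bigr => -[].
  by apply: eq_bigr => a _; rewrite mulr_sumr; apply: eq_bigr => e _; rewrite mulrCA.
move=> sum0 e; apply/eqP; apply: contrapT => /negP ce.
pose nz (a : 'I_N) := [exists e, c (a, e) != 0].
have nz0 : nz e.1 by apply/existsP; exists e.2; case: (e) ce.
(* a is the least power of x_0 that carries a nonzero coefficient. *)
case: (@arg_minnP _ e.1 nz (fun a => val a) nz0) => a nza amin.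
have [sub01 x1 x0] := xp 0%N isT.
have fx (b : 'I_N) : (b < a)%N -> f b = 0.
  move=> ba; rewrite /f big1 // => e' _.
  suff /eqP-> : c (b, e') == 0 by rewrite rmorph0 mul0r.
  apply: contraLR ba => cb; rewrite -leqNgt; apply: amin.
  by apply/existsP; exists e'.
(* Cofactor of x_0^(a+1) in the rest of the sum; the terms with b < a vanish and are replaced by 0
   to avoid a truncated exponent. *)
pose g := \sum_(b < N | b != a) (if (b < a)%N then 0 else x 0%N ^+ (b - a).-1 * f b).
have sumE : \sum_(b < N) x 0%N ^+ b * f b = x 0%N ^+ a * (f a + x 0%N * g).
  rewrite (bigD1 a) //= mulrDr; congr (_ + _).
  rewrite !mulr_sumr; apply: eq_bigr => b ba; case: ifP => [/fx ->|nba].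
    by rewrite !mulr0.
  rewrite !mulrA -exprSr -exprD; congr (_ ^+ _ * _).
  by move: ba nba; rewrite -val_eqE /=; lia.
(* x_0 is outside p_0, so its power can be cancelled; since x_0 is in p_1, [f a] is then in p_1. *)
have : f a + x 0%N * g \in p 0%N.
  move: sum0; rewrite sumE prime_idealrM; case/orP => // x0a.
  suff x0' k : x 0%N ^+ k \notin p 0%N by move/negP: (x0' (val a)).
  elim: k => [|k IHk]; first by rewrite idealr1.
  by rewrite exprS prime_idealrM negb_or x0.
move=> /sub01 fa1; have {fa1} : f a \in p 1%N.
  by rewrite -(addrK (x 0%N * g) (f a)) rpredB // mulrC idealMr.
move=> /(IH (fun k => p k.+1) (fun k => x k.+1) (fun e => c (a, e))) c0.
have {}c0 : forall e, c (a, e) = 0 by apply: c0 => j jn; apply: xp.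
by case/existsP: nza => e'; rewrite c0 eqxx.
Qed.
End MonomialsAlongChain.

Lemma deg_le_power_product (K : fieldType) (M : nmodType) (deg : M -> nat)
    (D N n : nat) (x : nat -> monoid_algebra K M) (e : exponent N n) :
  deg 0 = 0%N -> (forall a b, deg (a + b) = (deg a + deg b)%N) ->
  (forall j, (j < n)%N -> deg_le deg D (x j)) ->
  deg_le deg (n * (N * D)) (power_product x e).
Proof.
move=> deg0 degD; elim: n x e => [|n IH] x e xD /=.
  by rewrite -monom10; apply: deg_le_monom; rewrite deg0.
rewrite mulSn; apply: deg_leM => //; last by apply: IH => j /(xD j.+1).
apply: (@deg_le_mono _ _ _ (e.1 * D)); first by rewrite leq_mul // ltnW.
by apply: deg_leX => //; apply: (xD 0%N).
Qed.

(** A longer chain would give d+1 algebraically independent elements, by [chain_independent]. Their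
    N^(d+1) monomials with exponents below N have degree O(N), hence lie in a space of dimension
    O(N^d). *)
Lemma krull_dim_le_monoid_algebra (K : fieldType) (M : nmodType)
    (deg : M -> nat) (d C : nat) :
  deg 0 = 0%N -> (forall a b, deg (a + b) = (deg a + deg b)%N) ->
  (forall n, exists s : seq M,
     (forall a, (deg a <= n)%N -> a \in s) /\ (size s <= (C * n.+1) ^ d)%N) ->
  krull_dim_le (monoid_algebra K M) d.
Proof.
move=> deg0 degD box k p chp; rewrite leqNgt; apply/negP => dk.
pose q (j : nat) : prime_idealr (monoid_algebra K M) := p (inord j).
have qq j : (j < k)%N -> strict_sub (q j) (q j.+1).
  by move=> jk; apply: chp; rewrite !inordK // ltnS ltnW.
have /choice[x xq] j : exists x, (j < k)%N -> x \in q j.+1 /\ x \notin q j.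
  have [/qq[_ nsub]|nk] := boolP (j < k)%N; last by exists 0.
  apply: contrapT => nx; apply: nsub => x xq; apply: contrapT => /negP nxq.
  by apply: nx; exists x.
have [D xD] : exists D, forall j, (j <= d)%N -> deg_le deg D (x j).
  elim: (d) => [|m [D xD]].
    have [D xD] := deg_le_exists deg (x 0%N); exists D => j.
    by rewrite leqn0 => /eqP ->.
  have [E xE] := deg_le_exists deg (x m.+1); exists (D + E)%N => j.
  rewrite leq_eqVlt => /predU1P[->|jm].
    by apply: deg_le_mono xE; apply: leq_addl.
  by apply: deg_le_mono (xD j jm); apply: leq_addr.
(* B N bounds the base of the box in degree (d+1) N D, and N > B^d yields (B N)^d < N^(d+1). *)
pose B := (C * (d.+1 * D).+1)%N; pose N := (B ^ d).+1.
have [s [sdeg ss]] := box (d.+1 * (N * D))%N.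
have sN : (size s < #|exponent N d.+1|)%N.
  rewrite card_exponent; apply: (@leq_ltn_trans ((B * N) ^ d)).
    apply: leq_trans ss _; have [->//|d0] := posnP d.
    rewrite leq_exp2r // /B -mulnA leq_mul // [leqRHS]mulSn -mulnA (mulnC D) -add1n.
    by rewrite leq_add2r.
  by rewrite expnMn expnS ltn_pmul2r ?expn_gt0.
have vs (e : exponent N d.+1) a : (power_product x e)@_a != 0 -> a \in s.
  have ed : deg_le deg (d.+1 * (N * D)) (power_product x e).
    by apply: deg_le_power_product => // j; apply: xD.
  by move=> /ed; apply: sdeg.
have [c [[e ce] c0]] := linear_dependence vs sN.
have chain j : (j < d.+1)%N ->
    [/\ {subset q j <= q j.+1}, x j \in q j.+1 & x j \notin q j].
  move=> jd; have jk : (j < k)%N by apply: leq_trans dk.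
  by have [? _] := qq j jk; have [? ?] := xq j jk.
have := @chain_independent _ _ (@ma_const K M) _ _ q x c chain.
rewrite [X in X \in _]c0 idealr0 => /(_ isT e) /eqP.
by rewrite (negPf ce).
Qed.

(** * Semigroup rings of finitely generated monoids *)

Lemma submonoid_valP (V : nmodType) (S : addrClosed V) (a : submonoid_of S) :
  val a \in S.
Proof. by case: a. Qed.

Lemma gen_monoid_generated d (s : seq 'rV[int]_d) :
  exists gs : seq (submonoid_of (gen_monoid s)),
  forall a (Q : submonoid_of (gen_monoid s) -> Prop), Q 0 ->
    (forall g x, g \in gs -> Q x -> Q (g + x)) -> Q a.
Proof.
have memg (j : 'I_(size s)) : s`_j \in gen_monoid s.
  apply/asboolP; exists (fun k => nat_of_bool (k == j)).
  rewrite (bigD1 j) //= eqxx mulr1n big1 ?addr0 // => k /negPf->.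
  by rewrite mulr0n.
pose g j : submonoid_of (gen_monoid s) := SubmonoidOf (memg j).
exists (map g (enum 'I_(size s))) => a Q Q0 Qg.
have /asboolP[n an] := submonoid_valP a.
have {an} -> : a = \sum_j g j *+ n j.
  by apply: val_inj; rewrite an raddf_sum; apply: eq_bigr => j _; rewrite raddfMn.
pose Q' z := forall x, Q x -> Q (z + x).
suff : Q' (\sum_j g j *+ n j) by move=> /(_ 0 Q0); rewrite addr0.
apply: (big_ind Q') => [x|x y Qx Qy z Qz|j _]; first by rewrite add0r.
  by rewrite -addrA; apply/Qx/Qy.
elim: (n j) => [|k IH] x Qx; first by rewrite mulr0n add0r.
by rewrite mulrS -addrA; apply: Qg; [apply/map_f/mem_enum|apply: IH].
Qed.

Lemma semigroup_ring_generated (K : fieldType) d (s : seq 'rV[int]_d) :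
  exists bs : seq (semigroup_ring K (gen_monoid s)),
    generated_over (@ma_const K _) bs.
Proof.
have [gs gen] := gen_monoid_generated s.
by exists (map (monom 1) gs); apply: generated_over_monoms gen.
Qed.

Lemma noetherian_semigroup_ring (K : fieldType) d (s : seq 'rV[int]_d) :
  noetherian (semigroup_ring K (gen_monoid s)).
Proof.
have [bs gen] := semigroup_ring_generated K s.
exact: (noetherian_generated (@noetherian_field K) gen).
Qed.

(** * The monoid of the example *)

Definition cx (x : 'rV[int]_3) : int := x 0 (inord 0).
Definition cy (x : 'rV[int]_3) : int := x 0 (inord 1).
Definition cz (x : 'rV[int]_3) : int := x 0 (inord 2).

Lemma vec3E a b c :
  [/\ cx (vec3 a b c) = a, cy (vec3 a b c) = b & cz (vec3 a b c) = c].
Proof. by rewrite /cx /cy /cz /vec3; split; rewrite mxE inordK. Qed.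

Lemma vec3D a b c a' b' c' :
  vec3 a b c + vec3 a' b' c' = vec3 (a + a') (b + b') (c + c').
Proof. by apply/rowP => -[[|[|[|j]]] jlt] //=; rewrite !mxE. Qed.

Lemma vec3Mn a b c n : vec3 a b c *+ n = vec3 (a * n%:Z) (b * n%:Z) (c * n%:Z).
Proof.
elim: n => [|n IH].
  by apply/rowP => -[[|[|[|j]]] jlt] //=; rewrite !mxE /= mulr0.
by rewrite mulrS IH vec3D; congr vec3; lia.
Qed.

Lemma gen_monoidP d (s : seq 'rV[int]_d) x :
  reflect (exists n : nat -> nat, x = \sum_(j < size s) s`_j *+ n j)
          (x \in gen_monoid s).
Proof.
apply: (iffP (asboolP _)) => [[n ->]|[n ->]]; last by exists (fun j => n j).
exists (fun k => if insub k is Some j then n j else 0%N).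
by apply: eq_bigr => j _; rewrite valK.
Qed.

Lemma mem_gens_H x : reflect
  (exists n : nat -> nat, x = vec3 (n 0 + n 1 + n 2 + n 3 + n 4 + n 5)%N
    (n 1 + 3 * n 2 + 4 * n 3 + n 4 + 4 * n 5)%N (n 4 + n 5)%N)
  (x \in gen_monoid gens_H).
Proof.
apply: (iffP (gen_monoidP _ _)) => -[n ->]; exists n;
  rewrite !big_ord_recl big_ord0 /= /bump !leq0n !add1n /= !vec3Mn !addr0 !vec3D; congr vec3; lia.
Qed.

Lemma mem_gens_C x : reflect
  (exists n : nat -> nat, x = vec3 (n 0 + n 1 + n 2 + n 3)%N
    (n 1 + 3 * n 2 + 4 * n 3)%N 0)
  (x \in gen_monoid gens_C).
Proof.
apply: (iffP (gen_monoidP _ _)) => -[n ->]; exists n;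
  rewrite !big_ord_recl big_ord0 /= /bump !leq0n !add1n /= !vec3Mn !addr0 !vec3D; congr vec3; lia.
Qed.

(* In the coordinates m = y - 4 n + 3 k and i = n - k of a point (n, y, k) the
   generators are (m, i, k) = (-4, 1, 0), (-3, 1, 0), (-1, 1, 0), (0, 1, 0),
   (0, 0, 1) and (3, 0, 1), and H consists of the points with i >= min_i m
   and k >= min_k m. *)
Definition min_k (m : int) : nat := if m is Posz p then ((p + 2) %/ 3)%N else 0.

(** For m = p >= 0, the least multiple of 3 above p is corrected by steps -1. [Negz p] is m =
    -(p+1): steps -4, -3, -1 reach it in (p+1)/4 steps, rounded up, except that -2 takes two; this
    exception is the missing point (1, 2, 0). *)
Definition min_i (m : int) : nat :=
  match m with
  | Posz p => 3 * ((p + 2) %/ 3) - p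
  | Negz p => (p + 4) %/ 4 + (p == 1)
  end%N.

Definition pt (m : int) (i k : nat) : 'rV[int]_3 :=
  vec3 (i + k)%N (m + (4 * i + k)%N%:Z) k.

Lemma mem_H_exP x :
  x \in H_ex <->
  exists m i k, [/\ x = pt m i k, (min_i m <= i)%N & (min_k m <= k)%N].
Proof.
split=> [/mem_gens_H[n ->]|[m [i [k [-> im km]]]]].
  exists (3 * (n 5)%:Z - (4 * n 0 + 3 * n 1 + n 2)%N%:Z),
    (n 0 + n 1 + n 2 + n 3)%N, (n 4 + n 5)%N.
  move: (n 0) (n 1) (n 2) (n 3) (n 4) (n 5) => a b c d e f.
  split; [rewrite /pt; congr vec3; lia| |]; case E: (_ - _) => [p|p] /=; lia.
apply/mem_gens_H.
have [n nE] : exists n : nat -> nat, [/\ (n 0 + n 1 + n 2 + n 3 = i)%N,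
    (n 4 + n 5 = k)%N & m = 3 * (n 5)%:Z - (4 * n 0 + 3 * n 1 + n 2)%N%:Z].
  case: m im km => p /= im km.
    (* For m = p, take q copies of a_6, correct the excess 3 q - p by copies of a_3, and fill up
       with a_4 and a_5, which leave m unchanged. *)
    pose q := ((p + 2) %/ 3)%N.
    by exists (nth 0%N [:: 0; 0; 3 * q - p; i - (3 * q - p); k - q; q]%N);
      rewrite /q /=; split; lia.
  have [p1|p1] := eqVneq p 1%N.
    by exists (nth 0%N [:: 0; 0; 2; i - 2; k; 0]%N); rewrite p1 /= in im *; split; lia.
  (* Here a_1 accounts for the multiples of 4. Remainders 1 and 3 cost one a_3 or one a_2; remainder
     2 trades one a_1 for two a_2, since -4 - 2 = -3 - 3. *)
  pose c := (p.+1 %/ 4)%N; have := ltn_pmod p.+1 (isT : 0 < 4)%N.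
  have := divn_eq p.+1 4; rewrite -/c.
  case: (_ %% _)%N => [|[|[|[|//]]]] pE _.
  - by exists (nth 0%N [:: c; 0; 0; i - c; k; 0]%N); rewrite /=; split; lia.
  - by exists (nth 0%N [:: c; 0; 1; i - c.+1; k; 0]%N); rewrite /=; split; lia.
  - by exists (nth 0%N [:: c.-1; 2; 0; i - c.+1; k; 0]%N); rewrite /=; split; lia.
  - by exists (nth 0%N [:: c; 1; 0; i - c.+1; k; 0]%N); rewrite /=; split; lia.
exists n; case: nE => <- <- ->.
move: (n 0) (n 1) (n 2) (n 3) (n 4) (n 5) => a b c d e f.
by rewrite /pt; congr vec3; lia.
Qed.

(** * Coordinates on H and the bound on the dimension *)

Local Notation H := (submonoid_of H_ex).

Definition hm (h : H) : int := cy (val h) - 4 * cx (val h) + 3 * cz (val h).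
Definition hi (h : H) : nat := `|cx (val h) - cz (val h)|%N.
Definition hk (h : H) : nat := `|cz (val h)|%N.

Lemma coordP (h : H) :
  [/\ val h = pt (hm h) (hi h) (hk h), (min_i (hm h) <= hi h)%N
    & (min_k (hm h) <= hk h)%N].
Proof.
have /mem_H_exP[m [i [k [hE im km]]]] := submonoid_valP h.
have [cxE cyE czE] := vec3E (i + k)%N (m + (4 * i + k)%N%:Z) k.
have -> : hm h = m by rewrite /hm hE cxE cyE czE; lia.
have -> : hi h = i by rewrite /hi hE cxE czE; lia.
by have -> : hk h = k by rewrite /hk hE czE; lia.
Qed.

Lemma coord_pt (h : H) m i k :
  val h = pt m i k -> [/\ hm h = m, hi h = i & hk h = k].
Proof.
move=> hE; have [cxE cyE czE] := vec3E (i + k)%N (m + (4 * i + k)%N%:Z) k.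
by rewrite /hm /hi /hk hE cxE cyE czE; split; lia.
Qed.

Lemma ptD m i k m' i' k' :
  pt m i k + pt m' i' k' = pt (m + m') (i + i') (k + k').
Proof. by rewrite vec3D; congr vec3; lia. Qed.

Lemma coordD h g :
  [/\ hm (h + g) = hm h + hm g, hi (h + g) = (hi h + hi g)%N
    & hk (h + g) = (hk h + hk g)%N].
Proof.
have [hE _ _] := coordP h; have [gE _ _] := coordP g.
by apply: coord_pt; rewrite -ptD -hE -gE raddfD.
Qed.

Lemma coord_inj h g : hm h = hm g -> hi h = hi g -> hk h = hk g -> h = g.
Proof.
have [hE _ _] := coordP h; have [gE _ _] := coordP g => m i k.
by apply: val_inj; rewrite hE gE m i k.
Qed.

Lemma coord0 : [/\ hm 0 = 0, hi 0 = 0%N & hk 0 = 0%N].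
Proof. by apply: coord_pt; apply/rowP => -[[|[|[|j]]] jlt] //=; rewrite !mxE. Qed.

Definition mkH (m : int) (i k : nat) : H := insubd 0 (pt m i k).

Lemma mkHP m i k : (min_i m <= i)%N -> (min_k m <= k)%N ->
  [/\ hm (mkH m i k) = m, hi (mkH m i k) = i & hk (mkH m i k) = k].
Proof.
move=> im km; apply: coord_pt; rewrite /mkH val_insubd ifT //.
by apply/mem_H_exP; exists m, i, k.
Qed.

Lemma mkH_coord h : mkH (hm h) (hi h) (hk h) = h.
Proof.
by have [_ im km] := coordP h; have [? ? ?] := mkHP im km; apply: coord_inj.
Qed.

Lemma krull_dim_le_example (K : fieldType) : krull_dim_le (semigroup_ring K H_ex) 3.
Proof.
apply: (@krull_dim_le_monoid_algebra K H (fun h => hi h + hk h)%N 3 7).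
- by have [_ -> ->] := coord0.
- by move=> h g; have [_ -> ->] := coordD h g; lia.
(* Degree at most n forces -4 n <= m <= 3 n and i, k <= n; adding 4 n to m makes the first index a
   natural number. *)
move=> n; exists [seq mkH (p.1%:Z - (4 * n)%N%:Z) p.2.1 p.2.2 |
  p <- allpairs pair (iota 0 (7 * n).+1) (allpairs pair (iota 0 n.+1) (iota 0 n.+1))].
split=> [h hn|].
  have [_ im km] := coordP h.
  apply/mapP; exists (absz (hm h + (4 * n)%N%:Z), (hi h, hk h)).
    apply: (allpairs_f pair); last by apply: (allpairs_f pair); rewrite mem_iota; lia.
    by move: im km; rewrite mem_iota; case: (hm h) => p /=; lia.
  rewrite -[LHS]mkH_coord /=; congr mkH.
  by move: im km; case: (hm h) => p /=; lia.
rewrite size_map !size_allpairs !size_iota; nia.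
Qed.

(** This and the next lemma replace integer divisions by linear constraints, from which [lia]
    derives the later comparisons of thresholds. *)
Lemma min_kP m : (m <= 0 /\ min_k m = 0%N) \/
  (0 <= m /\ m <= 3 * (min_k m)%:Z <= m + 2).
Proof. by case: m => p /=; [right|left]; lia. Qed.

Lemma min_iP m : (0 <= m /\ (min_i m)%:Z = 3 * (min_k m)%:Z - m) \/
  (m = -2 /\ min_i m = 2%N) \/
  (m < 0 /\ m <> -2 /\ - m <= 4 * (min_i m)%:Z <= - m + 3).
Proof.
case: m => p /=; first by lia.
by case: (eqVneq p 1%N) => p1 /=; lia.
Qed.

(** * Regular sequences in K[u][v] *)

(** Divide p by g, with quotient s and remainder r: then g (b - s a) = a r, and a nonzero left side
    would have degree at least that of g, which exceeds that of r. *)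
Lemma dvd_const_monic_mul (D : idomainType) (a : D) (g b p : {poly D}) :
  a != 0 -> g \is monic -> g * b = p * a%:P -> exists q, b = q * a%:P.
Proof.
move=> a0 gm e; pose s := Pdiv.Ring.rdivp p g; pose r := Pdiv.Ring.rmodp p g.
have pE : p = s * g + r := Pdiv.RingMonic.rdivp_eq gm p.
have rg : (size r < size g)%N by rewrite Pdiv.Ring.ltn_rmodpN0 // monic_neq0.
exists s; apply/eqP; rewrite -subr_eq0; apply: contraTT rg => bs.
have rE : g * (b - s * a%:P) = a *: r.
  by rewrite mulrBr e pE -mul_polyC; ring.
rewrite -leqNgt -(size_scale r a0) -rE size_monicM //.
by rewrite -(ltn_predK (_ : 0 < size (b - s * a%:P)%R)%N) ?addnS ?leq_addr // size_poly_gt0.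
Qed.

Lemma weakly_regular_poly (K : fieldType) (f g : {poly K}) :
  f != 0 -> g != 0 -> weakly_regular [:: f%:P; map_poly polyC g].
Proof.
move=> f0 g0 [|[|//]] _ b /=.
  by move=> /ideal_gen_nil/eqP; rewrite mulf_eq0 polyC_eq0 (negPf f0) => /eqP/ideal_gen_nil.
case/(ideal_gen_rcons [::]) => p [_ [/ideal_gen_nil->]]; rewrite add0r => e.
(* The leading coefficient of g(v) lies in K, so g(v) can be normalized to be monic in v. *)
pose c := (lead_coef g)^-1; have c0 : lead_coef g != 0 by rewrite lead_coef_eq0.
have gm : c%:P *: map_poly polyC g \is monic.
  rewrite monicE lead_coefZ lead_coef_map_inj //; last exact: polyC_inj.
  by rewrite -polyCM mulVf.
have [|q ->] := dvd_const_monic_mul f0 gm (b := b) (p := c%:P *: p).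
  by rewrite -!scalerAl e.
by apply/(ideal_gen_rcons [::]); exists q, 0; rewrite add0r; split=> //; apply/ideal_gen_nil.
Qed.

(** * The free K[u, v]-module structure of K[H] *)

Section FreeModule.
Variables (K : fieldType) (M : nmodType).
Variables (hm : M -> int) (hi hk : M -> nat) (mkM : int -> nat -> nat -> M).
Hypothesis coord_ge : forall h, (min_i (hm h) <= hi h)%N /\ (min_k (hm h) <= hk h)%N.
Hypothesis coordD : forall h g, [/\ hm (h + g) = hm h + hm g,
  hi (h + g) = (hi h + hi g)%N & hk (h + g) = (hk h + hk g)%N].
Hypothesis coord0 : [/\ hm 0 = 0, hi 0 = 0%N & hk 0 = 0%N].
Hypothesis coord_inj :
  forall h g, hm h = hm g -> hi h = hi g -> hk h = hk g -> h = g.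
Hypothesis mkMP : forall m i k, (min_i m <= i)%N -> (min_k m <= k)%N ->
  [/\ hm (mkM m i k) = m, hi (mkM m i k) = i & hk (mkM m i k) = k].
Local Notation A := (monoid_algebra K M).
Local Notation B := {poly {poly K}}.
Local Notation cst := (@ma_const K M).

Lemma mkM_coord h : mkM (hm h) (hi h) (hk h) = h.
Proof.
by have [im km] := coord_ge h; have [? ? ?] := mkMP im km; apply: coord_inj.
Qed.

Lemma mkMD m i k m' i' k' : (min_i m <= i)%N -> (min_k m <= k)%N ->
  (min_i m' <= i')%N -> (min_k m' <= k')%N ->
  mkM m i k + mkM m' i' k' = mkM (m + m') (i + i') (k + k').
Proof.
move=> im km im' km'; have [e1 e2 e3] := mkMP im km.
have [f1 f2 f3] := mkMP im' km'.
have [g1 g2 g3] := coordD (mkM m i k) (mkM m' i' k').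
by rewrite -[LHS]mkM_coord g1 g2 g3 e1 e2 e3 f1 f2 f3.
Qed.

Definition mono (m : int) (i k : nat) : A := monom 1 (mkM m i k).

Lemma monoM m i k m' i' k' :
  (min_i m <= i)%N -> (min_k m <= k)%N ->
  (min_i m' <= i')%N -> (min_k m' <= k')%N ->
  mono m i k * mono m' i' k' = mono (m + m') (i + i') (k + k').
Proof.
move=> im km im' km'.
by rewrite [LHS]monomM mulr1 (mkMD im km im' km').
Qed.

Lemma mono1 : mono 0 0 0 = 1.
Proof.
have [m0 i0 k0] := coord0; rewrite /mono -monom10; congr monom.
by rewrite -[RHS]mkM_coord m0 i0 k0.
Qed.

Lemma mono_u n : mono 0 1 0 ^+ n = mono 0 n 0.
Proof.
by elim: n => [|n IH]; [rewrite expr0 mono1|rewrite exprS IH monoM // addr0 add1n addn0].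
Qed.

Lemma mono_v n : mono 0 0 1 ^+ n = mono 0 0 n.
Proof.
by elim: n => [|n IH]; [rewrite expr0 mono1|rewrite exprS IH monoM // addr0 add0n add1n].
Qed.

(** [B] stands for K[u][v]: the inner variable u goes to t^a4, the outer variable v to t^a5. *)
Definition ev : {rmorphism B -> A} := adjoin (adjoin cst (mono 0 1 0)) (mono 0 0 1).

Definition polyCC : {rmorphism K -> B} := polyC \o polyC.

(* The K[u, v]-linear coordinate along mono m (min_i m) (min_k m). *)
Definition chi (m : int) : A -> B := ma_ext polyCC (fun h =>
  if hm h == m then 'X^(hk h - min_k m) * ('X^(hi h - min_i m))%:P else 0).

Lemma chi_monom m c h : chi m (monom c h) = polyCC c *
  (if hm h == m then 'X^(hk h - min_k m) * ('X^(hi h - min_i m))%:P else 0).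
Proof. exact: ma_ext_monom. Qed.

Lemma chi_zmod m : zmod_morphism (chi m).
Proof. exact: ma_ext_zmod. Qed.

HB.instance Definition _ m := GRing.isZmodMorphism.Build A B (chi m) (chi_zmod m).

Lemma chiD m y z : chi m (y + z) = chi m y + chi m z.
Proof. exact: raddfD. Qed.

Lemma chi0 m : chi m 0 = 0.
Proof. exact: raddf0. Qed.

Lemma chi_cst m c y : chi m (cst c * y) = polyCC c * chi m y.
Proof.
elim/monoid_algebra_ind: y => [|y z IH IH'|d h].
- by rewrite mulr0 chi0 mulr0.
- by rewrite mulrDr !chiD IH IH' mulrDr.
- by rewrite ma_const_monom !chi_monom rmorphM mulrA.
Qed.

(** The factor measures by how much the shifted basis monomial exceeds the thresholds at [m0 + m];
    the inequalities make the truncated differences exact. *)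
Lemma chi_shift m m0 i0 k0 y :
  (min_i m0 <= i0)%N -> (min_k m0 <= k0)%N ->
  (min_i (m0 + m) <= i0 + min_i m)%N -> (min_k (m0 + m) <= k0 + min_k m)%N ->
  chi (m0 + m) (mono m0 i0 k0 * y) =
  'X^(k0 + min_k m - min_k (m0 + m)) * ('X^(i0 + min_i m - min_i (m0 + m)))%:P
  * chi m y.
Proof.
move=> im0 km0 im km; have [m0E i0E k0E] := mkMP im0 km0.
elim/monoid_algebra_ind: y => [|y z IH IH'|d h].
- by rewrite mulr0 !chi0 mulr0.
- by rewrite mulrDr !chiD IH IH' mulrDr.
rewrite [mono _ _ _ * _]monomM mul1r !chi_monom.
have [-> -> ->] := coordD (mkM m0 i0 k0) h; rewrite m0E i0E k0E.
rewrite (inj_eq (addrI m0)) mulrCA; congr (_ * _); have [hmE|] := eqVneq; last first.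
  by rewrite mulr0.
have [ih kh] := coord_ge h; rewrite hmE in ih kh.
rewrite mulrACA -exprD -polyCM -exprD.
by congr ('X^_ * ('X^_)%:P); lia.
Qed.

Lemma chi_ev m b y : chi m (ev b * y) = b * chi m y.
Proof.
pose Q b := forall y, chi m (ev b * y) = b * chi m y.
have QD p q : Q p -> Q q -> Q (p + q).
  by move=> Qp Qq z; rewrite rmorphD mulrDl chiD Qp Qq mulrDl.
have QM p q : Q p -> Q q -> Q (p * q).
  by move=> Qp Qq z; rewrite rmorphM -mulrA Qp Qq mulrA.
have Qc c : Q c%:P%:P by move=> z; rewrite /ev !adjoinC chi_cst.
have Qu : Q ('X%:P).
  move=> z; rewrite /ev adjoinC adjoinX -{1}[m]add0r chi_shift ?add0r //.
  by rewrite subnn add1n subSnn expr0 mul1r.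
have Qv : Q 'X.
  move=> z; rewrite /ev adjoinX -{1}[m]add0r chi_shift ?add0r //.
  by rewrite subnn add1n subSnn expr0 mulr1.
suff : Q b by apply.
elim/poly_ind: b => [|b c IH]; first exact: (Qc 0).
apply: (QD); first exact: QM.
elim/poly_ind: c => [|c d IH']; first exact: (Qc 0).
by rewrite polyCD polyCM; apply: (QD) => //; apply: QM.
Qed.

Lemma evCC c : ev (polyCC c) = cst c.
Proof. by rewrite /ev /= !adjoinC. Qed.

Lemma evu : ev 'X%:P = mono 0 1 0.
Proof. by rewrite /ev adjoinC adjoinX. Qed.

Lemma evv : ev 'X = mono 0 0 1.
Proof. by rewrite /ev adjoinX. Qed.

Lemma ev_monomial c p q : ev (polyCC c * ('X^p * ('X^q)%:P)) =
  cst c * (mono 0 0 1 ^+ p * mono 0 1 0 ^+ q).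
Proof.
by rewrite (rmorphXn polyC) rmorphM evCC rmorphM !(rmorphXn ev) evu evv.
Qed.

(** Each monomial of y is a monomial in u and v times the threshold monomial with the same m, so
    these span K[H] over K[u, v]. *)
Lemma chi_sum y : exists s, y =
  \sum_(m <- s) ev (chi m y) * mono m (min_i m) (min_k m).
Proof.
pose s := undup [seq hm h | h <- enum_fset (msupp y)].
exists s; have ys h : y@_h != 0 -> hm h \in s.
  by rewrite mcoeff_neq0 mem_undup => yh; apply: map_f.
have s_uniq : uniq s := undup_uniq _.
pose Q (z : A) := z = \sum_(m <- s) ev (chi m z) * mono m (min_i m) (min_k m).
apply: (monoid_algebra_supp_ind (Q := Q)) => [|z t Qz Qt|h /ys hs].
- by rewrite /Q big1 // => m _; rewrite chi0 rmorph0 mul0r.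
- rewrite /Q {1}Qz {1}Qt -big_split; apply: eq_bigr => m _.
  by rewrite chiD rmorphD mulrDl.
rewrite /Q (bigD1_seq (hm h)) //= big1 ?addr0 => [|m mh]; last first.
  by rewrite chi_monom eq_sym (negPf mh) mulr0 rmorph0 mul0r.
have [ih kh] := coord_ge h.
rewrite chi_monom eqxx ev_monomial mono_u mono_v -!mulrA monoM // monoM ?add0r ?leq_addl //.
by rewrite !add0n !subnK // ma_const_monom mulr1 mkM_coord.
Qed.

Lemma ideal_gen_rmorph (R S : comNzRingType) (f : {rmorphism R -> S}) s x :
  ideal_gen s x -> ideal_gen (map f s) (f x).
Proof.
case=> c ->; rewrite rmorph_sum; apply: is_ideal_sum => [|j _ _].
  exact: ideal_gen_ideal.
have [_ _ IM] := ideal_gen_ideal (map f s).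
by rewrite rmorphM; apply/IM/ideal_gen_mem/map_f/mem_nth.
Qed.

(** By freeness, membership in an ideal extended from K[u, v] is tested on coordinates; hence
    regular sequences of K[u, v] stay regular. *)
Lemma ideal_gen_chi bs y :
  ideal_gen (map ev bs) y <-> forall m, ideal_gen bs (chi m y).
Proof.
split=> [Jy m|Iy].
  have idB := ideal_gen_ideal bs; have [_ _ BM] := idB.
  case/ideal_genP: Jy => c ->; rewrite raddf_sum.
  apply: is_ideal_sum => // j _ _; rewrite /= mulrC.
  have jbs : (j < size bs)%N by rewrite -(size_map ev).
  by rewrite (nth_map 0) // chi_ev mulrC; apply/BM/ideal_gen_mem/mem_nth.
have [s ->] := chi_sum y; apply: is_ideal_sum => [|m _ _].
  exact: ideal_gen_ideal.
have [_ _ JM] := ideal_gen_ideal (map ev bs).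
by rewrite mulrC; apply/JM/ideal_gen_rmorph.
Qed.

Lemma weakly_regular_ev bs : weakly_regular bs -> weakly_regular (map ev bs).
Proof.
move=> reg i; rewrite size_map => ilt y.
rewrite -map_take (nth_map 0) // => /ideal_gen_chi Jy.
by apply/ideal_gen_chi => m; apply: reg => //; rewrite -chi_ev.
Qed.

(** This is t^a1 - t^a6. *)
Definition w : A := mono (- 4) 1 0 - mono 3 0 1.

(** For m >= -2 the thresholds move exactly with the shift: [min_i] is unchanged and [min_k] grows
    by 1. *)
Lemma chi_shift_up m y : exists b,
  chi (3 + m) (mono 3 0 1 * y) = b * chi m y /\ (-2 <= m -> b = 1).
Proof.
have [im [km eqs]] : (min_i (3 + m) <= 0 + min_i m)%N /\
    (min_k (3 + m) <= 1 + min_k m)%N /\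
    (-2 <= m -> min_i (3 + m) = (0 + min_i m)%N /\ min_k (3 + m) = (1 + min_k m)%N).
  move: (min_iP (3 + m)) (min_kP (3 + m)) (min_iP m) (min_kP m).
  move: (min_i (3 + m)) (min_k (3 + m)) (min_i m) (min_k m) => i' k' i k.
  by move=> *; split; [|split]; lia.
rewrite chi_shift //; eexists; split; first by [].
by move=> /eqs[-> ->]; rewrite !subnn !expr0 mul1r.
Qed.

(** For m <= -3, the range complementary to that of [chi_shift_up], [min_i] grows by 1 and [min_k]
    stays 0. *)
Lemma chi_shift_down m y : exists b,
  chi (- 4 + m) (mono (- 4) 1 0 * y) = b * chi m y /\ (m <= -3 -> b = 1).
Proof.
have [im [km eqs]] : (min_i (- 4 + m) <= 1 + min_i m)%N /\
    (min_k (- 4 + m) <= 0 + min_k m)%N /\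
    (m <= -3 -> min_i (- 4 + m) = (1 + min_i m)%N /\ min_k (- 4 + m) = (0 + min_k m)%N).
  move: (min_iP (- 4 + m)) (min_kP (- 4 + m)) (min_iP m) (min_kP m).
  move: (min_i (- 4 + m)) (min_k (- 4 + m)) (min_i m) (min_k m) => i' k' i k.
  by move=> *; split; [|split]; lia.
rewrite chi_shift //; eexists; split; first by [].
by move=> /eqs[-> ->]; rewrite !subnn !expr0 mul1r.
Qed.

Lemma chi_w n y : exists b b',
  [/\ chi n (w * y) = b * chi (n + 4) y - b' * chi (n - 3) y,
      n <= - 7 -> b = 1 & 1 <= n -> b' = 1].
Proof.
have [b [bE b1]] := chi_shift_down (n + 4) y.
have [b' [b'E b'1]] := chi_shift_up (n - 3) y.
exists b, b'; split=> [|n7|n1]; [|apply: b1; lia|apply: b'1; lia].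
have e4 : - 4 + (n + 4) = n by ring.
have e3 : 3 + (n - 3) = n by ring.
by rewrite -bE -b'E e4 e3 /w mulrBl; apply: raddfB.
Qed.

(** * Regularity of the third parameter *)

Section ThirdElement.
Variable I : B -> Prop.
Hypothesis idI : is_ideal I.

(* Only the top-degree term of f(w) y reaches the extremal coordinate, where it
   is a unit multiple of b. *)
Lemma leading_coordinate (f : {poly K}) (y : A) n (b : B) (e : B) :
  f != 0 -> e * e = 1 -> (forall j, (j < (size f).-1)%N -> I (chi n (w ^+ j * y))) ->
  I (chi n (w ^+ (size f).-1 * y) - e * b) -> I (chi n (adjoin cst w f * y)) -> I b.
Proof.
move=> f0 e1 low top; have [I0 ID IM] := idI.
have sf : size f = (size f).-1.+1 by rewrite prednK // size_poly_gt0.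
have -> : adjoin cst w f * y = \sum_(j < size f) cst f`_j * (w ^+ j * y).
  rewrite adjoinE (horner_coef_wide _ (size_poly _ _)) mulr_suml.
  by apply: eq_bigr => j _; rewrite coef_map mulrA.
rewrite raddf_sum sf big_ord_recr /= => Isum.
have Ilow : I (\sum_(j < (size f).-1) chi n (cst f`_j * (w ^+ j * y))).
  by apply: is_ideal_sum => // j _ _; rewrite chi_cst; apply/IM/low.
have := is_idealB idI Isum Ilow; rewrite addrAC subrr add0r chi_cst => Itop.
have l0 : lead_coef f != 0 by rewrite lead_coef_eq0.
have {Itop} : I (chi n (w ^+ (size f).-1 * y)).
  rewrite -[chi _ _]mul1r -(rmorph1 polyCC) -(mulVf l0) rmorphM -mulrA.
  exact: IM.
move=> /(is_idealB idI)/(_ top); rewrite opprB addrC subrK => /(IM e).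
by rewrite mulrA e1 mul1r.
Qed.

(** The a_6 part of w carries the top coordinate up by 3 with sign -1, while the a_1 part
    contributes only from coordinates above the current top, which lie in I. *)
Lemma chi_w_ge y t : -2 <= t -> (forall n, t < n -> I (chi n y)) -> forall j,
  (forall n, t + (3 * j)%N%:Z < n -> I (chi n (w ^+ j * y))) /\
  I (chi (t + (3 * j)%N%:Z) (w ^+ j * y) - (-1) ^+ j * chi t y).
Proof.
have [I0 ID IM] := idI; move=> t2 yt; elim=> [|j [IH IHt]].
  split=> [n|]; first by rewrite muln0 addr0 expr0 mul1r; apply: yt.
  by rewrite muln0 addr0 !expr0 !mul1r subrr.
split=> [n tn|].
  have [b [b' [e _ _]]] := chi_w n (w ^+ j * y).
  by rewrite exprS -mulrA e; apply: is_idealB => //; apply/IM/IH; lia.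
set n := t + _; have [b [b' [e _ b'1]]] := chi_w n (w ^+ j * y).
rewrite exprS -mulrA e b'1; last by rewrite /n; lia.
have -> : n - 3 = t + (3 * j)%N%:Z by rewrite /n; lia.
rewrite mul1r exprS mulN1r mulNr opprK -addrA; apply: (ID).
  by apply/IM/IH; rewrite /n; lia.
by rewrite addrC -opprB -[- _]sub0r; apply: is_idealB.
Qed.

(** Mirror image at the bottom coordinate: the a_1 part carries it down by 4, and the a_6 part
    contributes only from below. *)
Lemma chi_w_le y t : t <= -3 -> (forall n, n < t -> I (chi n y)) -> forall j,
  (forall n, n < t - (4 * j)%N%:Z -> I (chi n (w ^+ j * y))) /\
  I (chi (t - (4 * j)%N%:Z) (w ^+ j * y) - chi t y).
Proof.
have [I0 ID IM] := idI; move=> t3 yt; elim=> [|j [IH IHt]].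
  split=> [n|]; first by rewrite muln0 subr0 expr0 mul1r; apply: yt.
  by rewrite muln0 subr0 !expr0 !mul1r subrr.
split=> [n tn|].
  have [b [b' [e _ _]]] := chi_w n (w ^+ j * y).
  by rewrite exprS -mulrA e; apply: is_idealB => //; apply/IM/IH; lia.
set n := t - _; have [b [b' [e b1 _]]] := chi_w n (w ^+ j * y).
rewrite exprS -mulrA e b1; last by rewrite /n; lia.
have -> : n + 4 = t - (4 * j)%N%:Z by rewrite /n; lia.
rewrite mul1r addrAC; apply: is_idealB => //.
by apply/IM/IH; rewrite /n; lia.
Qed.

Lemma chi_bounded y : exists N : nat, forall n, (N < absz n)%N -> chi n y = 0.
Proof.
elim/monoid_algebra_ind: y => [|y z [N yN] [N' zN]|c h].
- by exists 0%N => n _; apply: chi0.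
- exists (N + N')%N => n nN; rewrite chiD yN ?zN ?addr0 //; lia.
exists (absz (hm h)) => n nN; rewrite chi_monom ifF ?mulr0 //.
by apply/negbTE/eqP => hn; rewrite hn ltnn in nN.
Qed.

(** Coordinates from -2 upwards are put into I by descending induction from the top of y, those from
    -3 downwards by ascending induction from the bottom. *)
Lemma third_regular (f : {poly K}) y : f != 0 ->
  (forall n, I (chi n (adjoin cst w f * y))) -> forall n, I (chi n y).
Proof.
move=> f0 Iy; have [N yN] := chi_bounded y; have [I0 _ _] := idI.
pose d := (size f).-1.
have above k n : -2 <= n -> N%:Z < n + k%:Z -> I (chi n y).
  elim: k n => [|k IH] n n2 nN; first by rewrite yN //; lia.
  have yt m : n < m -> I (chi m y) by move=> nm; apply: IH; lia.
  have ge := chi_w_ge n2 yt; have [_ top] := ge d.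
  apply: (leading_coordinate f0 _ _ top (Iy _)); first by rewrite -exprMn mulrNN mulr1 expr1n.
  by move=> j jd; have [low _] := ge j; apply: low; rewrite /d; lia.
have {above} above n : -2 <= n -> I (chi n y).
  by move=> n2; apply: (above (N + 3)%N) => //; lia.
have below k n : n <= -3 -> n - k%:Z < - N%:Z -> I (chi n y).
  elim: k n => [|k IH] n n3 nN; first by rewrite yN //; lia.
  have yt m : m < n -> I (chi m y) by move=> nm; apply: IH; lia.
  have le := chi_w_le n3 yt; have [_ top] := le d.
  rewrite -[X in _ - X]mul1r in top.
  apply: (leading_coordinate f0 _ _ top (Iy _)); first by rewrite mulr1.
  by move=> j jd; have [low _] := le j; apply: low; rewrite /d; lia.
move=> n; have [n2|n2] := boolP (-2 <= n); first exact: above.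
by apply: (below (N + absz n + 1)%N); lia.
Qed.
End ThirdElement.

Lemma maximal_ideal_regular (bs : seq A) (P : prime_idealr A) :
  generated_over cst bs -> maximal_ideal P ->
  exists s : seq A, [/\ weakly_regular s, {subset s <= P} & size s = 3].
Proof.
move=> gen maxP.
have [f1 f10 f1P] := Nullstellensatz (mono 0 1 0) gen maxP.
have [f2 f20 f2P] := Nullstellensatz (mono 0 0 1) gen maxP.
have [f3 f30 f3P] := Nullstellensatz w gen maxP.
(* f1(u) and f2(v) come from K[u, v], where they form a regular sequence; h(w) is handled by
   [third_regular]. *)
pose cs : seq B := [:: f1%:P; map_poly polyC f2].
have ev1 : ev f1%:P = adjoin cst (mono 0 1 0) f1 by rewrite /ev adjoinC.
have ev2 : ev (map_poly polyC f2) = adjoin cst (mono 0 0 1) f2.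
  rewrite /ev !adjoinE -map_poly_comp; congr (_.[_]).
  by apply: eq_map_poly => c /=; rewrite adjoinC.
exists (rcons (map ev cs) (adjoin cst w f3)); split=> //; last first.
  by move=> z; rewrite mem_rcons !inE ev1 ev2 => /or3P[]/eqP->.
apply/weakly_regular_rcons; split.
  exact/weakly_regular_ev/weakly_regular_poly.
move=> y /ideal_gen_chi Iy; apply/ideal_gen_chi.
exact: (@third_regular _ (ideal_gen_ideal cs) f3 y f30 Iy).
Qed.
End FreeModule.

Lemma cohen_macaulay_example (K : fieldType) :
  cohen_macaulay (semigroup_ring K H_ex).
Proof.
apply: (@cohen_macaulay_criterion _ 3).
- exact: noetherian_semigroup_ring.
- exact: krull_dim_le_example.
have [bs gen] := semigroup_ring_generated K gens_H.
have ge h : (min_i (hm h) <= hi h)%N /\ (min_k (hm h) <= hk h)%N.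
  by case: (coordP h).
move=> P maxP.
exact: (maximal_ideal_regular ge coordD coord0 coord_inj mkHP gen maxP).
Qed.

(** * The face ring *)

Lemma kernel_prime (R : comNzRingType) (S : idomainType) (f : {rmorphism R -> S}) :
  exists P : prime_idealr R, forall x, (x \in P) = (f x == 0).
Proof.
have [|||P PE] := @prime_idealr_exists R (fun x => f x = 0).
- split=> [|x y fx fy|a x fx]; first exact: rmorph0.
    by rewrite rmorphD fx fy addr0.
  by rewrite rmorphM fx mulr0.
- by rewrite rmorph1; apply/eqP/oner_neq0.
- by move=> x y /eqP; rewrite rmorphM mulf_eq0 => /orP[]/eqP; [left|right].
by exists P => x; apply/idP/eqP => /PE.
Qed.

(* M is the monoid of the pairs (a, b) with b <= 4 a, other than (1, 2). *)
Section FaceRing.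
Variables (K : fieldType) (M : nmodType) (ca cb : M -> nat) (mkM : nat -> nat -> M).
Hypothesis ca0 : ca 0 = 0%N.
Hypothesis cb0 : cb 0 = 0%N.
Hypothesis caD : forall h g, ca (h + g) = (ca h + ca g)%N.
Hypothesis cbD : forall h g, cb (h + g) = (cb h + cb g)%N.
Hypothesis c_inj : forall h g, ca h = ca g -> cb h = cb g -> h = g.
Hypothesis cb_le : forall h, (cb h <= 4 * ca h)%N.
Hypothesis c_neq12 : forall h, ca h = 1%N -> cb h <> 2%N.
Hypothesis mkMP : forall a b, (b <= 4 * a)%N -> (a, b) <> (1%N, 2%N) ->
  ca (mkM a b) = a /\ cb (mkM a b) = b.
Local Notation A := (monoid_algebra K M).
Local Notation B := {poly {poly K}}.
Local Notation cst := (@ma_const K M).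

(** In this polynomial ring b = t^(1, 2, 0) becomes available; [ca] is the degree in the inner
    variable, [cb] in the outer one. *)
Lemma face_embedding : exists phi : {rmorphism A -> B},
  forall c h, phi (monom c h) = c%:P%:P * (('X^(ca h))%:P * 'X^(cb h)).
Proof.
apply: (@ma_ext_rmorphism K M B (polyC \o polyC)
  (fun h => ('X^(ca h))%:P * 'X^(cb h))).
  by rewrite ca0 cb0 !expr0 mulr1.
by move=> h g; rewrite caD cbD !exprD polyCM mulrACA.
Qed.

(** Restriction to the ray of a_1, multiplicative because a sum lies on the ray only if both terms
    do. Its kernel is the middle prime of the chain. *)
Lemma face_edge : exists phi : {rmorphism A -> {poly K}}, forall c h,
  phi (monom c h) = c%:P * (if cb h == 0%N then 'X^(ca h) else 0).
Proof.
apply: (@ma_ext_rmorphism K M {poly K} polyC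
  (fun h => if cb h == 0%N then 'X^(ca h) else 0)).
  by rewrite ca0 cb0 expr0.
move=> h g; rewrite caD cbD addn_eq0 exprD.
by case: eqP => _; case: eqP => _ /=; rewrite ?mulr0 ?mul0r.
Qed.

Lemma face_origin : exists phi : {rmorphism A -> K},
  forall c h, phi (monom c h) = c * (ca h == 0%N)%:R.
Proof.
apply: (@ma_ext_rmorphism K M K idfun (fun h => (ca h == 0%N)%:R)).
  by rewrite ca0.
by move=> h g; rewrite caD addn_eq0 -mulnb natrM.
Qed.

Lemma coef_monomial (c : K) a b i j :
  (c%:P%:P * (('X^a)%:P * 'X^b))`_j`_i = c * ((j == b) && (i == a))%:R.
Proof.
rewrite !coefCM coefXn; case: eqP => _; last by rewrite mulr0 coef0.
by rewrite mulr1 coefXn.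
Qed.

Lemma not_cohen_macaulay_face : ~ cohen_macaulay A.
Proof.
have [phi phiE] := face_embedding; have [psi psiE] := face_edge.
have [eta etaE] := face_origin.
have phi_coef y h : (phi y)`_(cb h)`_(ca h) = y@_h.
  elim/monoid_algebra_ind: y => [|y z IH IH'|d g].
  - by rewrite rmorph0 !coef0 mcoeff0.
  - by rewrite rmorphD !coefD IH IH' mcoeff_add.
  rewrite phiE coef_monomial mcoeff_monom; have [->|gh] := eqVneq g h.
    by rewrite !eqxx mulr1.
  rewrite (_ : _ && _ = false) ?mulr0 //; apply: contraNF gh.
  by case/andP=> /eqP b /eqP a; apply/eqP/c_inj.
have phi_inj y z : phi y = phi z -> y = z.
  by move=> yz; apply/malgP => h; rewrite -!phi_coef yz.
(* The point (1, 2) is the hole of M, so this coefficient vanishes on the whole face ring. *)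
have phi12 y : (phi y)`_2`_1 = 0.
  elim/monoid_algebra_ind: y => [|y z IH IH'|d g].
  - by rewrite rmorph0 !coef0.
  - by rewrite rmorphD !coefD IH IH' addr0.
  rewrite phiE coef_monomial (_ : _ && _ = false) ?mulr0 //.
  by apply/negP => /andP[/eqP/esym gb /eqP/esym ga]; apply: (c_neq12 ga).
have eta_psi y : eta y = (psi y).[0].
  elim/monoid_algebra_ind: y => [|y z IH IH'|d g].
  - by rewrite !rmorph0 horner0.
  - by rewrite !rmorphD hornerD IH IH'.
  rewrite etaE psiE hornerCM; congr (_ * _); have [_|gb] := eqVneq (cb g) 0%N.
    by rewrite hornerXn expr0n.
  rewrite horner0; have := cb_le g; case: eqP => // ->.
  by rewrite muln0 leqn0 (negPf gb).
have eta_phi y : (phi y)`_0`_0 = eta y.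
  elim/monoid_algebra_ind: y => [|y z IH IH'|d g].
  - by rewrite !rmorph0 !coef0.
  - by rewrite !rmorphD !coefD IH IH'.
  rewrite phiE coef_monomial etaE; congr (_ * _); have := cb_le g.
  by case: (ca g) => [|m] /=; rewrite ?andbF // muln0 leqn0 eq_sym => ->.
have [Q0 Q0E] := kernel_prime phi; have [Q1 Q1E] := kernel_prime psi.
have [P PE] := kernel_prime eta.
have maxP : maximal_ideal P.
  split; first exact: prime_idealr_idealr_closed.
  (* For x in I outside P, [eta x] is a nonzero constant, and x - eta x in P puts this unit into
     I. *)
  move=> I clI PI x; have [I0 ID IM] := idealr_closed_ideal clI.
  apply/idP/idP => [Ix|/PI //]; rewrite PE; apply: contrapT => /negP ex.
  have [_ /negP I1 _] := clI; apply: I1.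
  have eta_cst c : eta (cst c) = c by rewrite etaE ca0 mulr1.
  have Pd : x - cst (eta x) \in P by rewrite PE rmorphB eta_cst subrr.
  have Ic : cst (eta x) \in I.
    by rewrite -[cst _](subKr x); apply: (is_idealB (idealr_closed_ideal clI)) => //; apply: PI.
  by rewrite -(rmorph1 cst) -(mulVf ex) rmorphM; apply: IM.
have Q01 : strict_sub Q0 Q1.
  split=> [y|Q10]; first by rewrite Q0E Q1E -(rmorph0 phi) => /eqP/phi_inj->; rewrite rmorph0.
  have [a1 b1] := mkMP (isT : 1 <= 4 * 1)%N (fun e => ltac:(by case: e)).
  have : monom 1 (mkM 1 1) \in Q1 by rewrite Q1E psiE b1 mulr0.
  move/Q10; rewrite Q0E -(rmorph0 phi) => /eqP/phi_inj/(congr1 (mcoeff (mkM 1 1))).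
  by rewrite mcoeff_monom eqxx mcoeff0 => /eqP; rewrite oner_eq0.
have Q1P : strict_sub Q1 P.
  split=> [y|PQ]; first by rewrite Q1E PE eta_psi => /eqP->; rewrite horner0.
  have [a1 b1] := mkMP (isT : 0 <= 4 * 1)%N (fun e => ltac:(by case: e)).
  have : monom 1 (mkM 1 0) \in P by rewrite PE etaE a1 mulr0.
  by move/PQ; rewrite Q1E psiE a1 b1 /= mul1r polyX_eq0.
apply: (not_cohen_macaulay_criterion maxP Q01 Q1P) => x y xP yP.
(* Multiplication by b maps P into the face ring: a nonzero point has first coordinate at least 1,
   so adding (1, 2) to it misses the hole. *)
have shift z : z \in P -> exists z', phi z' = 'X%:P * 'X^2 * phi z.
  move=> zP; pose Q z := exists z', phi z' = 'X%:P * 'X^2 * phi z.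
  apply: (monoid_algebra_supp_ind (Q := Q)) => [|f g [f' fE] [g' gE]|h hz].
  - by exists 0; rewrite !rmorph0 mulr0.
  - by exists (f' + g'); rewrite !rmorphD fE gE mulrDr.
  have h0 : ca h != 0%N.
    apply: contraNneq hz => h0; rewrite -phi_coef h0.
    have -> : cb h = 0%N by have := cb_le h; rewrite h0; lia.
    by rewrite eta_phi -PE.
  have [||ea eb] := @mkMP (ca h).+1 (cb h + 2).
  - by have := cb_le h; lia.
  - by case=> h1 _; rewrite h1 in h0.
  exists (monom z@_h (mkM (ca h).+1 (cb h + 2))).
  by rewrite !phiE ea eb exprS polyCM exprD; ring.
have [x' xE] := shift x xP; have [y' yE] := shift y yP.
exists x', y'; split; first by apply: phi_inj; rewrite !rmorphM xE yE; ring.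
move=> u c uP /(congr1 phi); rewrite !rmorphM xE => e.
apply/phi_inj/eqP; rewrite rmorph0; apply: contraNT uP => x0.
(* For x nonzero, cancelling it gives u b = c. At (1, 2) the left side has the constant term of u
   and the right side 0, so u would be in P. *)
have {}e : phi u * ('X%:P * 'X^2) = phi c.
  by apply: (mulfI x0); rewrite -e; ring.
have := phi12 c; rewrite -e mulrA coefMXn /= coefMC coefMX /=.
by rewrite PE -eta_phi => ->.
Qed.
End FaceRing.

(** * The face C *)

Lemma cz_max x : cz x = x 0 ord_max.
Proof. by rewrite /cz; congr (x 0 _); apply: val_inj; rewrite /= inordK. Qed.

Lemma H_ex_coord_ge0 x : x \in H_ex -> [/\ 0 <= cx x, 0 <= cy x & 0 <= cz x].
Proof.
by case/mem_gens_H=> n ->; have [-> -> ->] := vec3E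
  (n 0 + n 1 + n 2 + n 3 + n 4 + n 5)%N
  (n 1 + 3 * n 2 + 4 * n 3 + n 4 + 4 * n 5)%N (n 4 + n 5)%N.
Qed.

Lemma rational_cone_mem d (H : {pred 'rV[int]_d}) x :
  x \in H -> ratv x \in rational_cone H.
Proof.
move=> xH; apply/asboolP; exists [:: (1, x)]; rewrite big_seq1 scale1r.
by split=> // p; rewrite inE => /eqP->.
Qed.

(** A point of H with third coordinate 0 uses neither a_5 nor a_6, whose third coordinate is 1. *)
Lemma face_points : lattice_points H_ex cone_C =i gen_monoid gens_C.
Proof.
move=> x; apply/andP/mem_gens_C => [[/mem_gens_H[n xE] /andP[_]]|[n xE]].
  rewrite mxE intr_eq0 -cz_max xE.
  have [_ _ ->] := vec3E (n 0 + n 1 + n 2 + n 3 + n 4 + n 5)%N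
    (n 1 + 3 * n 2 + 4 * n 3 + n 4 + 4 * n 5)%N (n 4 + n 5)%N.
  rewrite eqz_nat addn_eq0 => /andP[/eqP n4 /eqP n5].
  by exists n; rewrite n4 n5 !addn0.
have xH : x \in H_ex.
  apply/mem_gens_H; exists (fun j => if (j < 4)%N then n j else 0%N).
  by rewrite /= !addn0.
split=> //; apply/andP; split; first exact: rational_cone_mem.
rewrite mxE intr_eq0 -cz_max xE.
by have [_ _ ->] := vec3E (n 0 + n 1 + n 2 + n 3)%N (n 1 + 3 * n 2 + 4 * n 3)%N 0.
Qed.

Lemma mem_facePn x : x \in lattice_points H_ex cone_C <->
  exists a b : nat, [/\ x = vec3 a b 0, (b <= 4 * a)%N & (a, b) <> (1, 2)%N].
Proof.
rewrite face_points; split=> [/mem_gens_C[n ->]|[a [b [-> ba ab]]]].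
  exists (n 0 + n 1 + n 2 + n 3)%N, (n 1 + 3 * n 2 + 4 * n 3)%N.
  split=> //; first by lia.
  by move: (n 0) (n 1) (n 2) (n 3) => i j k l [] *; lia.
have [n [<- <-]] : exists n : nat -> nat, (n 0 + n 1 + n 2 + n 3)%N = a /\
    (n 1 + 3 * n 2 + 4 * n 3)%N = b.
  pose q := (b %/ 4)%N; have := ltn_pmod b (isT : 0 < 4)%N.
  have := divn_eq b 4; rewrite -/q; case: (_ %% _)%N => [|[|[|[|//]]]] bE _.
  - by exists (nth 0%N [:: a - q; 0; 0; q]%N); rewrite /=; lia.
  - by exists (nth 0%N [:: a - q.+1; 1; 0; q]%N); rewrite /=; lia.
  (* Remainder 2 is the critical case: b = 2 needs two a_2, hence a >= 2; otherwise two a_3 replace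
     one a_4, since 3 + 3 = 4 + 2. *)
  - have [q0|q0] := posnP q.
      have a1 : a <> 1%N by move=> a1; apply: ab; rewrite a1 bE q0.
      by exists (nth 0%N [:: a - 2; 2; 0; 0]%N); rewrite /=; lia.
    by exists (nth 0%N [:: a - q.+1; 0; 2; q.-1]%N); rewrite /=; lia.
  - by exists (nth 0%N [:: a - q.+1; 0; 1; q]%N); rewrite /=; lia.
by apply/mem_gens_C; exists n.
Qed.

Lemma not_cohen_macaulay_example (K : fieldType) :
  ~ cohen_macaulay (semigroup_ring K (lattice_points H_ex cone_C)).
Proof.
pose S : addrClosed 'rV[int]_3 := lattice_points H_ex cone_C.
pose M := submonoid_of S.
pose a (h : M) := absz (cx (val h)); pose b (h : M) := absz (cy (val h)).
pose mk i j : M := insubd 0 (vec3 (Posz i) (Posz j) 0).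
have coord (h : M) i j : val h = vec3 (Posz i) (Posz j) 0 -> a h = i /\ b h = j.
  by move=> hE; rewrite /a /b hE; have [-> -> _] := vec3E i j 0.
have hP (h : M) : [/\ val h = vec3 (Posz (a h)) (Posz (b h)) 0,
    (b h <= 4 * a h)%N & (a h, b h) <> (1, 2)%N].
  have /mem_facePn[i [j [hE ij ne]]] := submonoid_valP h.
  by have [-> ->] := coord _ _ _ hE.
have abD h g : a (h + g) = (a h + a g)%N /\ b (h + g) = (b h + b g)%N.
  apply: coord; have [hE _ _] := hP h; have [gE _ _] := hP g.
  by rewrite raddfD /= hE gE vec3D addr0.
have ab0 : a 0 = 0%N /\ b 0 = 0%N.
  by apply: coord; apply/rowP => -[[|[|[|j]]] jlt] //=; rewrite !mxE.
apply: (@not_cohen_macaulay_face K M a b mk).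
- by case: ab0.
- by case: ab0.
- by move=> h g; case: (abD h g).
- by move=> h g; case: (abD h g).
- move=> h g ah bh; apply: val_inj.
  by have [-> _ _] := hP h; have [-> _ _] := hP g; rewrite ah bh.
- by move=> h; case: (hP h).
- by move=> h ah bh; case: (hP h) => _ _; rewrite ah bh.
move=> i j ij ne; apply: coord; rewrite /mk val_insubd ifT //.
by apply/mem_facePn; exists i, j.
Qed.

Lemma linear_form_col (d : nat) (j : 'I_d) (x : 'rV[rat]_d) :
  linear_form (\col_i (i == j)%:R) x = x 0 j.
Proof.
rewrite /linear_form mxE (bigD1 j) //= mxE eqxx mulr1 big1 ?addr0 // => i ij.
by rewrite mxE (negPf ij) mulr0.
Qed.

Lemma is_face_C : is_face (rational_cone H_ex) cone_C.
Proof.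
exists (\col_i (i == ord_max)%:R); split=> x.
  case/asboolP=> r [rP ->]; rewrite linear_form_col summxE big_seq.
  apply: sumr_ge0 => p /rP[p0 pH]; rewrite !mxE mulr_ge0 // ler0z -cz_max.
  by case: (H_ex_coord_ge0 pH).
by rewrite [RHS]inE /= linear_form_col.
Qed.

Lemma cone_dim_C : cone_dim cone_C 2.
Proof.
pose e1 : 'rV[rat]_3 := ratv (vec3 1 0 0).
pose e2 : 'rV[rat]_3 := ratv (vec3 1 1 0).
have eE i : (e1 0 i = (i == 0 :> nat)%:R) * (e2 0 i = (i < 2)%N%:R).
  by split; rewrite !mxE; case: i => [[|[|[|i]]] ilt].
have eC (n : nat -> nat) : vec3 (n 0 + n 1 + n 2 + n 3)%N
    (n 1 + 3 * n 2 + 4 * n 3)%N 0 \in lattice_points H_ex cone_C.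
  by rewrite face_points; apply/mem_gens_C; exists n.
have e1C : e1 \in cone_C by case/andP: (eC (nth 0%N [:: 1%N])).
have e2C : e2 \in cone_C by case/andP: (eC (nth 0%N [:: 0; 1]%N)).
exists <<[:: e1; e2]>>%VS; split.
- move=> x /andP[_ /eqP x2].
  have -> : x = (x 0 0 - x 0 1) *: e1 + x 0 1 *: e2.
    apply/rowP => i; rewrite !mxE.
    have [i0|[i1|i2]] : i = 0 \/ i = 1 \/ i = ord_max.
      by case: i => [[|[|[|i]]] ilt] //; [left|right; left|right; right]; apply: val_inj.
    + by rewrite i0 /= !mulr1 subrK.
    + by rewrite i1 /= mulr0 mulr1 add0r.
    + by rewrite i2 /= x2 !mulr0 addr0.
  by rewrite rpredD // rpredZ // memv_span // !inE eqxx ?orbT.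
- by move=> W CW; apply/span_subvP => e; rewrite !inE => /orP[]/eqP->; apply: CW.
apply/eqP; rewrite -/(free [:: e1; e2]) free_cons seq1_free span_seq1.
apply/andP; split.
  apply/negP => /vlineP[k /rowP e]; move: (e 1) (e 0).
  by rewrite ![(k *: e2) _ _]mxE !eE /= !mulr1 => <- /eqP; rewrite oner_eq0.
by apply/eqP => /rowP/(_ 0)/eqP; rewrite eE mxE oner_eq0.
Qed.

(** Every generator has first coordinate 1. *)
Lemma on_affine_hyperplane_gens_H : on_affine_hyperplane gens_H.
Proof.
exists (\col_i (i == 0)%:R), 1; split=> //.
  by apply/eqP => /colP/(_ 0)/eqP; rewrite !mxE eqxx oner_eq0.
by move=> a; rewrite linear_form_col !inE mxE => /or4P[|||/or3P[]] /eqP->; rewrite mxE.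
Qed.

Theorem mainTheorem2 (K : fieldType) :
  [/\ is_face (rational_cone H_ex) cone_C /\ cone_dim cone_C 2,
      lattice_points H_ex cone_C =i gen_monoid gens_C,
      cohen_macaulay (semigroup_ring K H_ex)
        /\ ~ cohen_macaulay (semigroup_ring K (lattice_points H_ex cone_C)),
      on_affine_hyperplane gens_H
    & ~ (forall (d : nat) (s : seq 'rV[int]_d) (F : addrClosed 'rV[rat]_d),
           on_affine_hyperplane s ->
           is_face (rational_cone (gen_monoid s)) F ->
           cohen_macaulay (semigroup_ring K (gen_monoid s)) ->
           cohen_macaulay
             (semigroup_ring K (lattice_points (gen_monoid s) F)))].
Proof.
have CM := cohen_macaulay_example K; have nCM := @not_cohen_macaulay_example K.
split=> //.
- by split; [apply: is_face_C|apply: cone_dim_C].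
- exact: face_points.
- exact: on_affine_hyperplane_gens_H.
move=> faces; apply: nCM.
exact: (faces 3 gens_H cone_C on_affine_hyperplane_gens_H is_face_C CM).
Qed.
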